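(* Let $a \in \mathbb{Z}_+^n$ and let $\beta, \sigma$ be positive integers such that $a$ is $\sigma$-sparse, where $0 < a_i \le \beta$ for all $i \in [n]$ and $\sum_{i=1}^n a_i > \beta$. Then the separation problem of lifted cover inequalities (LCIs) for $K^{a,\beta} = \{x \in \{0,1\}^n : a^\top x \le \beta\}$ can be solved in $\mathcal{O}(\sigma^2 n^{2\sigma})$ time. That is, there is an algorithm which, given $a$, $\beta$ and a vector $\bar{x} \in \mathbb{R}^n$, decides within this running time whether there exists an LCI for $K^{a,\beta}$ that is violated by $\bar{x}$.
   Context: Notation: $[n] = \{1,\dots,n\}$; running time counts elementary operations (arithmetic operations, comparisons and table look-ups on numbers have unit cost). Sparsity: $a$ is $\sigma$-sparse if the number of distinct values among $a_1,\dots,a_n$ is at most $\sigma$. Covers: a set $C \subseteq [n]$ is a cover if $\sum_{i \in C} a_i > \beta$; it is minimal if no proper subset of $C$ is a cover. Lifting data of a minimal cover $C$: write $C = \{j_1,\dots,j_{|C|}\}$ with $a_{j_1} \ge a_{j_2} \ge \dots \ge a_{j_{|C|}}$. For every integer $h \ge 0$ put $\mu(h) = \sum_{i=1}^{\min\{h,|C|\}} a_{j_i}$ (so $\mu(0)=0$). For $i \notin C$ put $\pi_i = \max\{h \in \mathbb{Z}_{\geq 0} : a_i \ge \mu(h)\}$. Put $\Delta(C) = \sum_{i\in C} a_i - \beta$. A set $S \subseteq [n]\setminus C$ is independent (with respect to $C$) if every subset $Q \subseteq S$ satisfies $\sum_{i \in Q} a_i > \mu\bigl(\sum_{i \in Q}(\pi_i+1)\bigr)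 - \Delta(C)$. An independent set is maximal if it is not properly contained in another independent set. LCI: for a minimal cover $C$ and a maximal independent set $S$ with respect to $C$, the corresponding lifted cover inequality is $$\sum_{i\in C} x_i + \sum_{i\in S} (\pi_i + 1) x_i + \sum_{i\in [n]\setminus(C\cup S)} \pi_i x_i \le |C| - 1 .$$ The LCIs for $K^{a,\beta}$ are exactly the inequalities of this form. *)

(* Defs.v *)
From mathcomp Require Import all_boot all_order all_algebra.
From mathcomp Require Import reals.

Set Implicit Arguments.
Unset Strict Implicit.
Unset Printing Implicit Defensive.

Import Order.TTheory GRing.Theory Num.Theory.

(** * Covers and lifted cover inequalities

    Indices are ['I_n] = {0, ..., n-1} instead of {1, ..., n}. *)

Section Covers.
Local Open Scope nat_scope.
Variables (n : nat) (a : n.-tuple nat) (beta : nat).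
Implicit Types (C S Q : {set 'I_n}) (i : 'I_n).

Definition is_sparse (sigma : nat) : bool := size (undup a) <= sigma.

Definition weight Q : nat := \sum_(i in Q) tnth a i.

Definition is_cover C : bool := beta < weight C.

Definition minimal_cover C : bool := minset is_cover C.

(* [take h] keeps min(h, #|C|) entries. *)
Definition mu C (h : nat) : nat :=
  sumn (take h (sort geq [seq tnth a i | i in C])).

(* The maximum is over all h : nat; when C is a cover and a_i <= beta it is
   attained below #|C|.+1, see [lift_coefP]. *)
Definition lift_coef C i : nat :=
  \max_(h < #|C|.+1 | mu C h <= tnth a i) h.

Lemma mu_large C h : #|C| <= h -> mu C h = weight C.
Proof.
move=> le_Ch; rewrite /mu take_oversize; last by rewrite size_sort size_image.
have /permPl/perm_sumn-> := perm_sort geq [seq tnth a i | i in C].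
by rewrite sumnE big_image.
Qed.

Lemma lift_coefP C i : is_cover C -> tnth a i <= beta ->
  mu C (lift_coef C i) <= tnth a i /\
  (forall h, mu C h <= tnth a i -> h <= lift_coef C i).
Proof.
move=> covC le_ai; split=> [|h le_mu].
  have [|h mu_h eq_h] := @eq_bigmax_cond _
      [pred h : 'I_#|C|.+1 | mu C h <= tnth a i] (@nat_of_ord _).
    by apply/card_gt0P; exists ord0; rewrite inE /= /mu take0.
  by rewrite [lift_coef C i]eq_h.
have [le_hC | lt_Ch] := leqP h #|C|.
  by apply: (@leq_bigmax_cond _ _ (@nat_of_ord _) (Ordinal (le_hC : h < _.+1))).
move: le_mu; rewrite mu_large ?(ltnW lt_Ch) // leqNgt.
by rewrite (leq_ltn_trans le_ai covC).
Qed.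

(* The excess is an integer: the right-hand side of the independence condition
   may be negative, so truncated subtraction would be wrong there. *)
Definition excess C : int := ((weight C)%:Z - beta%:Z)%R.

Definition independent C S : bool :=
  (S \subset ~: C) &&
  [forall Q : {set 'I_n}, (Q \subset S) ==>
     ((mu C (\sum_(i in Q) (lift_coef C i).+1))%:Z - excess C
        < (weight Q)%:Z)%R].

Definition maximal_independent C S : bool := maxset (independent C) S.

Definition lci_lhs (R : realType) C S (x : n.-tuple R) : R :=
  (\sum_(i in C) tnth x i
   + \sum_(i in S) (lift_coef C i).+1%:R * tnth x i
   + \sum_(i in ~: (C :|: S)) (lift_coef C i)%:R * tnth x i)%R.

Definition lci_rhs (R : realType) C : R := (#|C|%:R - 1)%R.

Definition exists_violated_lci (R : realType) (x : n.-tuple R) : Prop :=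
  exists C S, [/\ minimal_cover C, maximal_independent C S
                & (lci_rhs R C < lci_lhs C S x)%R].

End Covers.

(** * Unit-cost machine

    Programs are finite and contain no real constants.  The memory consists of
    arrays of natural numbers and arrays of real numbers, with zero-initialised
    cells; array names are literals and array indices are computed natural
    numbers.  Every constant, look-up, arithmetic operation, comparison,
    Boolean connective, assignment and branching costs 1.  There is no rounding
    of reals and no division of naturals. *)

Inductive nexp : Type :=
  | NConst of nat
  | NGet of nat & nexp
  | NAdd of nexp & nexp
  | NSub of nexp & nexp
  | NMul of nexp & nexp.

Inductive rexp : Type :=
  | ROfNat of nexp
  | RGet of nat & nexp
  | RAdd of rexp & rexp
  | RSub of rexp & rexp
  | RMul of rexp & rexp
  | RDiv of rexp & rexp.

Inductive bexp : Type :=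
  | BNLe of nexp & nexp
  | BRLe of rexp & rexp
  | BNot of bexp
  | BAnd of bexp & bexp.

Inductive cmd : Type :=
  | Skip
  | NSet of nat & nexp & nexp
  | RSet of nat & nexp & rexp
  | Seq of cmd & cmd
  | If of bexp & cmd & cmd
  | While of bexp & cmd.

Section Semantics.
Variable R : realType.

Record state : Type := State { nmem : nat -> nat -> nat; rmem : nat -> nat -> R }.

Definition upd (T : Type) (m : nat -> nat -> T) (A k : nat) (v : T) :
    nat -> nat -> T :=
  fun B l => if (B == A) && (l == k) then v else m B l.

(* Subtraction of naturals is truncated. *)
Fixpoint neval (s : state) (e : nexp) : nat :=
  match e with
  | NConst k => k
  | NGet A e1 => nmem s A (neval s e1)
  | NAdd e1 e2 => neval s e1 + neval s e2
  | NSub e1 e2 => neval s e1 - neval s e2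
  | NMul e1 e2 => neval s e1 * neval s e2
  end%N.

Fixpoint reval (s : state) (e : rexp) : R :=
  match e with
  | ROfNat e1 => (neval s e1)%:R
  | RGet A e1 => rmem s A (neval s e1)
  | RAdd e1 e2 => reval s e1 + reval s e2
  | RSub e1 e2 => reval s e1 - reval s e2
  | RMul e1 e2 => reval s e1 * reval s e2
  | RDiv e1 e2 => reval s e1 / reval s e2
  end%R.

Fixpoint beval (s : state) (b : bexp) : bool :=
  match b with
  | BNLe e1 e2 => (neval s e1 <= neval s e2)%N
  | BRLe e1 e2 => (reval s e1 <= reval s e2)%R
  | BNot b1 => ~~ beval s b1
  | BAnd b1 b2 => beval s b1 && beval s b2
  end.

Fixpoint ncost (e : nexp) : nat :=
  match e with
  | NConst _ => 1
  | NGet _ e1 => (ncost e1).+1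
  | NAdd e1 e2 | NSub e1 e2 | NMul e1 e2 => (ncost e1 + ncost e2).+1
  end.

Fixpoint rcost (e : rexp) : nat :=
  match e with
  | ROfNat e1 | RGet _ e1 => (ncost e1).+1
  | RAdd e1 e2 | RSub e1 e2 | RMul e1 e2 | RDiv e1 e2 =>
      (rcost e1 + rcost e2).+1
  end.

Fixpoint bcost (b : bexp) : nat :=
  match b with
  | BNLe e1 e2 => (ncost e1 + ncost e2).+1
  | BRLe e1 e2 => (rcost e1 + rcost e2).+1
  | BNot b1 => (bcost b1).+1
  | BAnd b1 b2 => (bcost b1 + bcost b2).+1
  end.

(* [exec c s t s']: started in [s], [c] halts in [s'] after exactly [t]
   elementary operations. *)
Inductive exec : cmd -> state -> nat -> state -> Prop :=
  | ExecSkip s : exec Skip s 1 s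
  | ExecNSet A e1 e2 s :
      exec (NSet A e1 e2) s (ncost e1 + ncost e2).+1
        (State (upd (nmem s) A (neval s e1) (neval s e2)) (rmem s))
  | ExecRSet A e1 e2 s :
      exec (RSet A e1 e2) s (ncost e1 + rcost e2).+1
        (State (nmem s) (upd (rmem s) A (neval s e1) (reval s e2)))
  | ExecSeq c1 c2 s1 s2 s3 t1 t2 :
      exec c1 s1 t1 s2 -> exec c2 s2 t2 s3 ->
      exec (Seq c1 c2) s1 (t1 + t2) s3
  | ExecIf b c1 c2 s t s' :
      exec (if beval s b then c1 else c2) s t s' ->
      exec (If b c1 c2) s (bcost b + t).+1 s'
  | ExecWhileFalse b c s :
      ~~ beval s b -> exec (While b c) s (bcost b).+1 s
  | ExecWhileTrue b c s1 s2 s3 t1 t2 :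
      beval s1 b -> exec c s1 t1 s2 -> exec (While b c) s2 t2 s3 ->
      exec (While b c) s1 (bcost b + t1 + t2).+1 s3.

(* The natural arrays 0 and 1 hold (n, beta) and a, and the real array 0 holds
   x; the sparsity bound is not part of the input. *)
Definition input_state (n : nat) (a : n.-tuple nat) (beta : nat)
    (x : n.-tuple R) : state :=
  State (fun A k => match A with
                    | 0 => nth 0 [:: n; beta] k
                    | 1 => nth 0 a k
                    | _ => 0
                    end)
        (fun A k => if A == 0 then nth 0%R x k else 0%R).

(* The answer is read from cell 0 of the natural array 2. *)
Definition accepts (s : state) : bool := nmem s 2 0 != 0.

End Semantics.

(* Main.v *)
(* Whether [C] is a minimal cover, its lifting coefficients, and whether [S] is
   a maximal independent set depend only on how many elements [C] and [S] take
   from each of the k <= sigma classes of equal coefficients.  A vector of k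
   such numbers is encoded in base n + 1, so that there are (n + 1)^k <= 4 n^k
   codes, and all pairs of codes are enumerated with O(k) work per pair.

   Independence of all sets disjoint from a fixed [C] is tabulated by dynamic
   programming: [S] is independent iff it satisfies its own inequality and
   [S :\ i] is independent for every [i] in [S].  As independence is inherited
   by subsets, maximality is tested by adding single elements.

   For given cardinalities, the left-hand side of the inequality splits into
   contributions of the classes, and the largest contribution of a class with
   lifting coefficient p is attained by letting [S] take the largest entries
   of [x] and [C] the smallest ones if p > 0, or the next ones if p = 0.  It is
   a combination of sums of the m largest entries of [x] in the class. *)

Require Import Defs.
From mathcomp Require Import all_boot all_order all_algebra.
From mathcomp Require Import reals.
From mathcomp Require Import zify ring lra.

Set Implicit Arguments.
Unset Strict Implicit.
Unset Printing Implicit Defensive.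

Import Order.TTheory GRing.Theory Num.Theory.

Local Open Scope nat_scope.

(** * Structured programs with counted loops *)

(* In [SFor i X b] the counter [i] runs below the value of [X] at loop entry. *)
Inductive scmd : Type :=
  | SN of nat & nexp & nexp
  | SR of nat & nexp & rexp
  | SLe of nat & rexp & rexp
  | SSeq of scmd & scmd
  | SFor of nat & nat & scmd.

Notation cell A := (NGet A (NConst 0)).

(** A branch is generated only to store a comparison of reals as 0 or 1, and a loop only in counted
    form; all other case distinctions become arithmetic on 0/1 flags. *)
Fixpoint compile (c : scmd) : cmd :=
  match c with
  | SN A e1 e2 => NSet A e1 e2
  | SR A e1 e2 => RSet A e1 e2
  | SLe A e1 e2 =>
      If (BRLe e1 e2) (NSet A (NConst 0) (NConst 1))
         (NSet A (NConst 0) (NConst 0))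
  | SSeq c1 c2 => Seq (compile c1) (compile c2)
  | SFor i X b =>
      Seq (NSet i (NConst 0) (NConst 0))
        (While (BNLe (NAdd (cell i) (NConst 1)) (cell X))
           (Seq (compile b) (NSet i (NConst 0) (NAdd (cell i) (NConst 1)))))
  end.

Fixpoint nwrites (c : scmd) : seq nat :=
  match c with
  | SN A _ _ | SLe A _ _ => [:: A]
  | SR _ _ _ => [::]
  | SSeq c1 c2 => nwrites c1 ++ nwrites c2
  | SFor i _ b => i :: nwrites b
  end.

Fixpoint rwrites (c : scmd) : seq nat :=
  match c with
  | SR A _ _ => [:: A]
  | SN _ _ _ | SLe _ _ _ => [::]
  | SSeq c1 c2 => rwrites c1 ++ rwrites c2
  | SFor _ _ b => rwrites b
  end.

Fixpoint bounds (c : scmd) : seq nat :=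
  match c with
  | SN _ _ _ | SR _ _ _ | SLe _ _ _ => [::]
  | SSeq c1 c2 => bounds c1 ++ bounds c2
  | SFor _ X b => X :: bounds b
  end.

(* No loop counter or loop bound is overwritten by a command executed before
   the loop is over. *)
Fixpoint well_formed (c : scmd) : bool :=
  match c with
  | SN _ _ _ | SR _ _ _ | SLe _ _ _ => true
  | SSeq c1 c2 =>
      [&& well_formed c1, well_formed c2 & ~~ has (mem (nwrites c1)) (bounds c2)]
  | SFor i X b =>
      [&& well_formed b, i \notin nwrites b
        & ~~ has (mem (i :: nwrites b)) (X :: bounds b)]
  end.

(* [r X] bounds the number of iterations of the loops with bound [X]. *)
Fixpoint time (r : nat -> nat) (c : scmd) : nat :=
  match c with
  | SN _ e1 e2 => (ncost e1 + ncost e2).+1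
  | SR _ e1 e2 => (ncost e1 + rcost e2).+1
  | SLe _ e1 e2 => rcost e1 + rcost e2 + 5
  | SSeq c1 c2 => time r c1 + time r c2
  | SFor _ X b => r X * (time r b + 14) + 11
  end.

Lemma eq_time r1 r2 c : {in bounds c, r1 =1 r2} -> time r1 c = time r2 c.
Proof.
elim: c => //= [c1 IH1 c2 IH2|i X b IH] E.
  by rewrite IH1 ?IH2 // => A hA; apply: E; rewrite mem_cat hA ?orbT.
by rewrite IH ?E ?mem_head // => A hA; apply: E; rewrite inE hA orbT.
Qed.

(** * Denotation, frame rules and cost of structured programs *)

Section Run.
Variable R : realType.
Implicit Types (s : state R) (c b : scmd).

Definition nset s A v : state R := State (upd (nmem s) A 0 v) (rmem s).

(** A total denotation: the counter is set afresh before each round. This matches the compiled loop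
    because the body of a [well_formed] loop does not write its counter. *)
Fixpoint run c s : state R :=
  match c with
  | SN A e1 e2 => State (upd (nmem s) A (neval s e1) (neval s e2)) (rmem s)
  | SR A e1 e2 => State (nmem s) (upd (rmem s) A (neval s e1) (reval s e2))
  | SLe A e1 e2 => nset s A (reval s e1 <= reval s e2)%R
  | SSeq c1 c2 => run c2 (run c1 s)
  | SFor i X b =>
      nset (iteri (nmem s X 0) (fun j s' => run b (nset s' i j)) s)
        i (nmem s X 0)
  end.

Lemma run_nframe c s A : A \notin nwrites c -> nmem (run c s) A = nmem s A.
Proof.
have hupd m B l (v : nat) : A \notin [:: B] -> upd m B l v A = m A.
  by rewrite inE /upd => /negbTE ->.
elim: c s => //= [B e1 e2|B e1 e2|c1 IH1 c2 IH2|i X b IH] s.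
- exact: hupd.
- exact: hupd.
- by rewrite mem_cat negb_or => /andP[h1 h2]; rewrite IH2 ?IH1.
- rewrite inE negb_or => /andP[hi hb]; rewrite hupd ?inE //.
  elim: (nmem s X 0) => //= j <-.
  by rewrite IH //= hupd ?inE.
Qed.

Lemma run_rframe c s A : A \notin rwrites c -> rmem (run c s) A = rmem s A.
Proof.
elim: c s => //= [B e1 e2|c1 IH1 c2 IH2|i X b IH] s.
- by rewrite inE /upd => /negbTE ->.
- by rewrite mem_cat negb_or => /andP[h1 h2]; rewrite IH2 ?IH1.
- by move=> hb; elim: (nmem s X 0) => //= j <-; rewrite IH.
Qed.

(** Invariant rule with frames built in: in every round the arrays that the loop does not write
    still have their values from loop entry, so [Inv] need only describe what changes. [Inv] must
    survive setting the counter, which is written once more after the last round. *)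
Lemma run_for_ind i X b (Inv : nat -> state R -> Prop) N s :
  nmem s X 0 = N ->
  (forall m s', Inv m s' -> Inv m (nset s' i m)) ->
  Inv 0 s ->
  (forall j s', j < N ->
     (forall A, A \notin i :: nwrites b -> nmem s' A = nmem s A) ->
     (forall A, A \notin rwrites b -> rmem s' A = rmem s A) ->
     Inv j s' -> Inv j.+1 (run b (nset s' i j))) ->
  Inv N (run (SFor i X b) s).
Proof.
move=> <- hset h0 hS /=; apply: (hset).
pose G j := iteri j (fun j s' => run b (nset s' i j)) s.
suff H j : j <= nmem s X 0 ->
   [/\ forall A, A \notin i :: nwrites b -> nmem (G j) A = nmem s A,
       forall A, A \notin rwrites b -> rmem (G j) A = rmem s A & Inv j (G j)].
  by have [] := H _ (leqnn _).
elim: j => // j IH lt_j.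
have [hn hr hI] := IH (ltnW lt_j); split=> [A|A|] /=; last exact: hS.
- move=> hA; have := hA; rewrite inE negb_or => /andP[hAi hAb].
  by rewrite run_nframe // -(hn A) //= /upd (negbTE hAi).
- by move=> hA; rewrite run_rframe //= hr.
Qed.

(** A round adds 8 for the successful guard and 6 for the increment, whence 14 in [time]; the reset
    costs 3 and the failing guard 8, whence 11. The frame rule keeps all loop bounds, hence the
    bound on the cost of the body, the same in every round. *)
Lemma exec_run c s : well_formed c ->
  exists2 t, exec (compile c) s t (run c s) & t <= time (nmem s ^~ 0) c.
Proof.
elim: c s => [A e1 e2|A e1 e2|A e1 e2|c1 IH1 c2 IH2|i X b IH] s.
- by exists (ncost e1 + ncost e2).+1 => //; constructor.
- by exists (ncost e1 + rcost e2).+1 => //; constructor.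
- move=> _; exists (bcost (BRLe e1 e2) + 3).+1; last by rewrite /=; lia.
  apply: ExecIf => /=; rewrite /nset.
  by case: (_ <= _)%R; [apply: (ExecNSet _ _ (NConst 1))
                       | apply: (ExecNSet _ _ (NConst 0))].
- case/and3P=> wf1 wf2 /hasPn dis.
  have [t1 ex1 le1] := IH1 s wf1.
  have [t2 ex2 le2] := IH2 (run c1 s) wf2.
  exists (t1 + t2); first by apply: ExecSeq ex1 ex2.
  apply: leq_add => //; apply: leq_trans le2 _.
  rewrite (@eq_time _ (nmem s ^~ 0)) // => A /dis hA.
  by rewrite run_nframe.
- case/and3P=> wfb i_nb; rewrite has_sym => /hasPn dis0.
  have dis A : A \in X :: bounds b -> A \notin i :: nwrites b.
    by apply: contraL => /dis0.
  have X_nb := dis X (mem_head _ _).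
  have {}dis A : A \in bounds b -> A \notin i :: nwrites b.
    by move=> hA; apply: dis; rewrite inE hA orbT.
  set N := nmem s X 0; set T := time (nmem s ^~ 0) b.
  pose G j := iteri j (fun j s' => run b (nset s' i j)) s.
  have hG j A : A \notin i :: nwrites b -> nmem (G j) A = nmem s A.
    move=> hA; have := hA; rewrite inE negb_or => /andP[hAi hAb].
    elim: j => // j IHj; rewrite -IHj /= run_nframe //= /upd.
    by rewrite (negbTE hAi).
  pose W := While (BNLe (NAdd (cell i) (NConst 1)) (cell X))
           (Seq (compile b) (NSet i (NConst 0) (NAdd (cell i) (NConst 1)))).
  (* Induction on the number [d] of rounds left, because [exec] unfolds a loop from its first round
     whereas [G] counts the rounds done. *)
  have Wend d : d <= N -> exists2 t, exec W (nset (G (N - d)) i (N - d)) t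
       (nset (G N) i N) & t <= d * (T + 14) + 8.
    have hX j : nmem (nset (G j) i j) X 0 = N.
      rewrite /= /upd; move: X_nb; rewrite inE negb_or => /andP[hXi hXb].
      by rewrite (negbTE hXi) /= hG // inE negb_or hXi.
    have hi j : nmem (nset (G j) i j) i 0 = j by rewrite /= /upd !eqxx.
    elim: d => [_|d IHd lt_d].
      rewrite subn0; exists 8 => //; apply: ExecWhileFalse.
      by rewrite /beval /neval hX hi addn1 ltnn.
    have [t ext let_] := IHd (ltnW lt_d).
    set j := N - d.+1; have jE : N - d = j.+1 by rewrite /j; lia.
    have [tb exb leb] := IH (nset (G j) i j) wfb.
    exists (7 + (tb + 6) + t).+1.
      apply: ExecWhileTrue; last exact: ext.
        rewrite /beval /neval hX hi addn1 /j; lia.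
      apply: ExecSeq exb _.
      rewrite jE.
      have -> : nset (G j.+1) i j.+1 =
        State (upd (nmem (run b (nset (G j) i j))) i 0
          (neval (run b (nset (G j) i j)) (NAdd (cell i) (NConst 1))))
          (rmem (run b (nset (G j) i j))).
        by rewrite /nset /= run_nframe //= /upd !eqxx addn1.
      exact: (ExecNSet i (NConst 0) (NAdd (cell i) (NConst 1))).
    have : tb <= T.
      apply: leq_trans leb _; rewrite (@eq_time _ (nmem s ^~ 0)) // => A /dis hA.
      move: hA; rewrite /= inE negb_or => /andP[hAi hAb].
      rewrite /upd (negbTE hAi) /= hG // inE negb_or hAi //.
    by move: let_; rewrite mulSn; lia.
  have [t ext let_] := Wend N (leqnn N).
  exists (3 + t); last by rewrite /= -/N -/T; lia.
  apply: ExecSeq; last by move: ext; rewrite subnn; apply.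
  exact: (ExecNSet i (NConst 0) (NConst 0)).
Qed.

Lemma run_SN A e1 e2 s : run (SN A e1 e2) s =
  State (upd (nmem s) A (neval s e1) (neval s e2)) (rmem s).
Proof. by []. Qed.

Lemma run_SR A e1 e2 s : run (SR A e1 e2) s =
  State (nmem s) (upd (rmem s) A (neval s e1) (reval s e2)).
Proof. by []. Qed.

Lemma run_SLe A e1 e2 s :
  run (SLe A e1 e2) s = nset s A (reval s e1 <= reval s e2)%R.
Proof. by []. Qed.

Lemma run_seq c1 c2 s : run (SSeq c1 c2) s = run c2 (run c1 s).
Proof. by []. Qed.

Definition agree (L : seq nat) s s' := forall A, A \in L -> nmem s' A = nmem s A.

Lemma agree_frame (L W : seq nat) s s' :
  (forall A, A \notin W -> nmem s' A = nmem s A) -> ~~ has (mem W) L ->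
  agree L s s'.
Proof. by move=> hW /hasPn dis A /dis; apply: hW. Qed.

Lemma agree_run L c s : ~~ has (mem (nwrites c)) L -> agree L s (run c s).
Proof. by apply: agree_frame => A; apply: run_nframe. Qed.

Lemma agree_trans L s1 s2 s3 : agree L s1 s2 -> agree L s2 s3 -> agree L s1 s3.
Proof. by move=> h12 h23 A hA; rewrite h23 ?h12. Qed.

End Run.

Arguments upd _ _ _ _ _ _ /.
Opaque run.

(** * Value classes and their encoding *)

Definition digit (B z v : nat) := z %/ B ^ v %% B.

(** * Positional digits in base [B] *)

Section Digits.
Variable B : nat.
Hypothesis B_gt0 : 0 < B.

Lemma sum_digits_lt k (f : nat -> nat) : (forall v, v < k -> f v < B) ->
  \sum_(v < k) f v * B ^ v < B ^ k.
Proof.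
elim: k => [|k IH] hf; first by rewrite big_ord0 expn_gt0 B_gt0.
rewrite big_ord_recr /= expnS.
have h1 : \sum_(v < k) f v * B ^ v < B ^ k by apply: IH => v /ltnW; apply: hf.
have : f k * B ^ k <= B.-1 * B ^ k.
  by rewrite leq_mul2r -ltnS prednK // hf // orbT.
have -> : B * B ^ k = B ^ k + B.-1 * B ^ k by rewrite -mulSn prednK.
move=> h2.
by apply: leq_ltn_trans (leq_add (leqnn _) h2) _; rewrite ltn_add2r.
Qed.

(** Isolates a factor [B], so that a term of position [k] disappears from the digit at a lower
    position [v] after division by [B ^ v] and reduction modulo [B]. *)
Lemma expn_split k v : v < k -> B ^ k = B ^ (k - v.+1) * B * B ^ v.
Proof. by move=> lt_v; rewrite -expnSr -expnD; congr (_ ^ _); lia. Qed.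

Lemma digit_sum k (f : nat -> nat) v : (forall v, v < k -> f v < B) -> v < k ->
  digit B (\sum_(u < k) f u * B ^ u) v = f v.
Proof.
elim: k => // k IH hf.
have {}IH : v < k -> digit B (\sum_(u < k) f u * B ^ u) v = f v.
  by apply: IH => u /ltnW; apply: hf.
rewrite big_ord_recr /= addnC ltnS leq_eqVlt => /orP[/eqP->|lt_vk].
  rewrite /digit divnMDl ?expn_gt0 ?B_gt0 //.
  rewrite divn_small ?addn0 ?modn_small ?hf //.
  by apply: sum_digits_lt => u /ltnW; apply: hf.
rewrite -[RHS]IH // /digit (expn_split lt_vk) !mulnA.
by rewrite divnMDl ?expn_gt0 ?B_gt0 // modnMDl.
Qed.

Lemma sum_digit k z : z < B ^ k -> \sum_(v < k) digit B z v * B ^ v = z.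
Proof.
elim: k z => [|k IH] z lt_z.
  by rewrite big_ord0; move: lt_z; rewrite expn0; case: z.
rewrite big_ord_recr /= [RHS](divn_eq z (B ^ k)) addnC; congr (_ + _).
  rewrite /digit [_ %% B]modn_small // ltn_divLR ?expn_gt0 ?B_gt0 //.
  by rewrite -expnS.
rewrite -[RHS]IH ?ltn_mod ?expn_gt0 ?B_gt0 //.
apply: eq_bigr => v _; congr (_ * _).
rewrite /digit {1}(divn_eq z (B ^ k)) {2}(expn_split (ltn_ord v)) !mulnA.
by rewrite divnMDl ?expn_gt0 ?B_gt0 // modnMDl.
Qed.

End Digits.

(** * Classes of equal coefficients and codes of sets *)

Section Classes.
Variables (n : nat) (a : n.-tuple nat).
Implicit Types (A C S Q : {set 'I_n}) (i j : 'I_n) (v : nat).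

(** The order is decreasing, so that running through the classes by index lists a set in the order
    in which [mu] adds coefficients. *)
Definition values := sort geq (undup a).
Local Notation k := (size values).
Local Notation w := (nth 0 values).
Definition value_class v : {set 'I_n} := [set i | tnth a i == w v].
Local Notation V := value_class.
Definition class_card A v := #|A :&: V v|.
(* Base [n.+1] leaves room for every cardinality 0, ..., n. *)
Definition code A := \sum_(v < k) class_card A v * n.+1 ^ v.

Lemma values_uniq : uniq values.
Proof. by rewrite sort_uniq undup_uniq. Qed.

Lemma mem_values y : (y \in values) = (y \in tval a).
Proof. by rewrite mem_sort mem_undup. Qed.

Lemma values_sorted : sorted geq values.
Proof. by apply: sort_sorted => x y; exact: leq_total. Qed.

Lemma size_values : k = size (undup a).
Proof. by rewrite size_sort. Qed.

Lemma class_lt i : index (tnth a i) values < k.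
Proof. by rewrite index_mem mem_values mem_tnth. Qed.

Lemma mem_class i v : v < k -> (i \in V v) = (index (tnth a i) values == v).
Proof.
move=> lt_v; rewrite inE; apply/eqP/eqP => [->|<-].
  by rewrite index_uniq ?values_uniq.
by rewrite nth_index // mem_values mem_tnth.
Qed.

Lemma big_class (T : Type) (idx : T) (op : Monoid.com_law idx) A (F : 'I_n -> T) :
  \big[op/idx]_(i in A) F i =
  \big[op/idx]_(v < k) \big[op/idx]_(i in A :&: V v) F i.
Proof.
rewrite (partition_big (fun i => Ordinal (class_lt i)) xpredT) //.
apply: eq_bigr => v _; apply: eq_bigl => i.
by rewrite in_setI mem_class.
Qed.

Lemma sum_by_class A (g : nat -> nat) :
  \sum_(i in A) g (tnth a i) = \sum_(v < k) class_card A v * g (w v).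
Proof.
rewrite big_class; apply: eq_bigr => v _.
rewrite (eq_bigr (fun=> g (w v))) ?sum_nat_const // => i.
by rewrite !inE => /andP[_ /eqP->].
Qed.

Lemma card_by_class A : #|A| = \sum_(v < k) class_card A v.
Proof.
rewrite -sum1_card (sum_by_class A (fun=> 1)).
by apply: eq_bigr => v _; rewrite muln1.
Qed.

Lemma weight_by_class A : weight a A = \sum_(v < k) class_card A v * w v.
Proof. exact: (sum_by_class A id). Qed.

Lemma class_card_lt A v : class_card A v < n.+1.
Proof. by rewrite ltnS -[leqRHS]card_ord max_card. Qed.

Lemma class_card_le A v : class_card A v <= #|V v|.
Proof. by rewrite subset_leq_card // subsetIr. Qed.

Lemma code_lt A : code A < n.+1 ^ k.
Proof. by apply: sum_digits_lt => // v _; apply: class_card_lt. Qed.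

Lemma digit_code A v : v < k -> digit n.+1 (code A) v = class_card A v.
Proof. by apply: digit_sum => // u _; apply: class_card_lt. Qed.

(** Only the digit of the class of [i] changes, and by one. Thus removing or adding an element
    amounts to subtracting or adding a power of the base. *)
Lemma code_setD1 A i v : v < k -> i \in A -> i \in V v ->
  code A = code (A :\ i) + n.+1 ^ v.
Proof.
move=> lt_v iA iV; rewrite /code (bigD1 (Ordinal lt_v)) //=.
rewrite [in RHS](bigD1 (Ordinal lt_v)) //= addnAC.
have -> : class_card A v = (class_card (A :\ i) v).+1.
  by rewrite /class_card (cardsD1 i) inE iA iV setIDAC.
rewrite mulSn [_ ^ v + _]addnC; congr (_ + _).
apply: eq_bigr => u ne_u; congr (#|pred_of_set _| * _).
apply/setP => l; rewrite !inE; case: (l =P i) => //= ->; rewrite iA /=.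
apply/negbTE; move: iV; rewrite inE => /eqP->.
by rewrite nth_uniq ?values_uniq // eq_sym; apply: contra ne_u => /eqP h; apply/eqP/val_inj.
Qed.

(** Both lists are sorted, and they contain each value equally often. *)
Lemma sort_by_class A : sort geq [seq tnth a i | i in A] =
  flatten [seq nseq (class_card A v) (w v) | v <- iota 0 k].
Proof.
have geq_tr : transitive geq by move=> y x z /= h1 h2; apply: leq_trans h2 h1.
have hs m : m <= k ->
    sorted geq (flatten [seq nseq (class_card A v) (w v) | v <- iota 0 m]).
  rewrite (sorted_pairwise geq_tr); elim: m => // m IH lt_m.
  rewrite -addn1 iotaD map_cat flatten_cat /= cats0 pairwise_cat (IH (ltnW lt_m)) /=.
  apply/andP; split; last first.
    rewrite -(sorted_pairwise geq_tr).
    by case: (class_card A m) => //= c; elim: c => //= c ->; rewrite leqnn.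
  apply/allrelP => y z /flattenP[s /mapP[v]]; rewrite mem_iota => /= lt_v ->.
  rewrite !mem_nseq => /andP[_ /eqP->] /andP[_ /eqP->].
  have := values_sorted; rewrite (sorted_pairwise geq_tr) => /(pairwiseP 0).
  by apply; rewrite ?inE //; apply: ltn_trans lt_m.
apply: (sorted_eq geq_tr); [|apply: sort_sorted|exact: hs|].
- by move=> x y /= h; apply/eqP; rewrite eqn_leq andbC.
- by move=> x y; exact: leq_total.
rewrite (permPl (permEl (perm_sort _ _))); apply/permP => p.
rewrite -sum1_count big_image_cond /= big_mkcondr /=.
rewrite (eq_bigr (fun i => nat_of_bool (p (tnth a i)))) => [|i _]; last by case: (p _).
rewrite (sum_by_class A (fun y => p y)) count_flatten -map_comp sumnE big_map.
rewrite (_ : iota 0 k = index_iota 0 k) ?big_mkord; last by rewrite /index_iota subn0.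
by apply: eq_bigr => v _; rewrite /= count_nseq mulnC.
Qed.

End Classes.

(** * Lifted cover inequalities through class cardinalities *)

Section Lifting.
Variables (n : nat) (a : n.-tuple nat) (beta : nat).
Implicit Types (C S Q : {set 'I_n}) (i j : 'I_n) (v : nat).
Local Notation k := (size (values a)).
Local Notation w := (nth 0 (values a)).
Local Notation V := (value_class a).
Local Notation cnt := (class_card a).

Lemma weightD1 C i : i \in C -> weight a C = tnth a i + weight a (C :\ i).
Proof. by move=> iC; rewrite /weight (big_setD1 i). Qed.

Lemma weight_sub C Q : Q \subset C -> weight a Q <= weight a C.
Proof.
move=> sub; rewrite /weight [leqRHS](big_setID Q) /=.
by rewrite (setIidPr sub) leq_addr.
Qed.

(** Weight is monotone, so minimality need only be tested by deleting single elements, and the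
    effect of a deletion depends only on the class of the element. *)
Lemma minimal_coverE C : minimal_cover a beta C <->
  beta < weight a C /\
  forall v, v < k -> 0 < cnt C v -> weight a C <= beta + w v.
Proof.
split=> [/minsetP[covC minC]|[covC minC]].
  split=> // v lt_v /card_gt0P[i]; rewrite !inE => /andP[iC /eqP <-].
  rewrite (weightD1 iC) addnC leq_add2r leqNgt; apply/negP => cov.
  have /setP/(_ i) := minC _ cov (subD1set _ _).
  by rewrite !inE eqxx iC.
apply/minsetP; split=> // D covD subD; apply/eqP; rewrite eqEsubset subD /=.
apply/subsetP => i iC; apply/negPn/negP => iD.
have lt_v := class_lt a i; have iV : i \in V (index (tnth a i) (values a)).
  by rewrite mem_class.
have := minC _ lt_v; rewrite /class_card (cardsD1 i) inE iC iV => /(_ isT).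
have -> : w (index (tnth a i) (values a)) = tnth a i.
  by move: iV; rewrite inE => /eqP.
rewrite (weightD1 iC) addnC leq_add2r leqNgt => /negP[].
apply: leq_trans covD (weight_sub _).
by apply/subsetP=> l lD; rewrite !inE (subsetP subD) // andbT; apply: contraNneq iD => <-.
Qed.

Definition lift_value C y := \max_(h < #|C|.+1 | mu a C h <= y) h.

Lemma lift_coefE C i v : i \in V v -> lift_coef a C i = lift_value C (w v).
Proof. by rewrite inE => /eqP <-. Qed.

(** The inequality that independence demands of the single set [Q]; moving the excess to both sides
    makes all terms natural numbers. *)
Definition good C Q :=
  mu a C (\sum_(i in Q) (lift_coef a C i).+1) + beta < weight a Q + weight a C.

Lemma mu_minn C h : mu a C (minn h #|C|) = mu a C h.
Proof.
by case: (leqP h #|C|) => // lt_Ch; rewrite !mu_large // ltnW.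
Qed.

(** Since [mu] is constant from [#|C|] on, its argument may be capped there, which keeps it within
    the range that the program tabulates. *)
Lemma good_by_class C Q : good C Q =
  (mu a C (minn (\sum_(v < k) cnt Q v * (lift_value C (w v)).+1) #|C|) + beta <
   \sum_(v < k) cnt Q v * w v + weight a C).
Proof.
rewrite /good mu_minn -weight_by_class.
by rewrite -(sum_by_class a Q (fun y => (lift_value C y).+1)).
Qed.

Lemma independentE C S : independent a beta C S =
  (S \subset ~: C) && [forall Q : {set 'I_n}, (Q \subset S) ==> good C Q].
Proof.
congr (_ && _); apply: eq_forallb => Q; congr (_ ==> _).
rewrite /good /excess; lia.
Qed.

Lemma independentS C S Q : Q \subset S -> independent a beta C S ->
  independent a beta C Q.
Proof.
move=> sub; rewrite !independentE => /andP[sC /forallP ind].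
rewrite (subset_trans sub sC); apply/forallP => P; apply/implyP => sP.
exact: (implyP (ind P) (subset_trans sP sub)).
Qed.

(** A proper subset of [S] misses some [i] in [S], hence is already covered by the independence of
    [S :\ i]. *)
Lemma independent_rec C S : S \subset ~: C -> independent a beta C S =
  good C S && [forall i in S, independent a beta C (S :\ i)].
Proof.
move=> sC; apply/idP/andP => [ind|[gS /forall_inP ind]].
  split; last by apply/forall_inP => i _; apply: independentS ind; apply: subD1set.
  by move: ind; rewrite independentE => /andP[_ /forallP/(_ S)]; rewrite subxx.
rewrite independentE sC; apply/forallP => Q; apply/implyP => sQ.
have [->//|] := eqVneq Q S.
rewrite eqEsubset sQ /= => /subsetPn[i iS iQ].
have := ind i iS; rewrite independentE => /andP[_ /forallP/(_ Q)/implyP]; apply.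
by apply/subsetP => l lQ; rewrite !inE (subsetP sQ) // andbT; apply: contraNneq iQ => <-.
Qed.

(** A strictly larger independent set contains some [i |: S] with [i] new, and independence passes
    to this subset. *)
Lemma maximal_independentE C S : maximal_independent a beta C S <->
  independent a beta C S /\
  forall i, i \notin C :|: S -> ~~ independent a beta C (i |: S).
Proof.
split=> [/maxsetP[ind mx]|[ind mx]].
  split=> // i; rewrite inE negb_or => /andP[_ iS]; apply/negP => ind'.
  by move: iS; rewrite -(mx _ ind' (subsetUr _ _)) setU11.
apply/maxsetP; split=> // S' ind' sS; apply/eqP; rewrite eqEsubset sS andbT.
apply/subsetP => i iS'; apply/negPn/negP => iS.
have iC : i \notin C.
  by move: ind'; rewrite independentE => /andP[/subsetP/(_ i iS')]; rewrite inE.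
have := mx i; rewrite inE negb_or iC iS => /(_ isT)/negP; apply.
by apply: independentS ind'; rewrite subUset sub1set iS' sS.
Qed.

(** * The largest left-hand side for given class cardinalities *)

Section Value.
Variable R : realType.
Variable x : n.-tuple R.
Local Open Scope ring_scope.

(* Ties are broken by index, so that [before] is a strict total order. *)
Definition before i j : bool :=
  (tnth x j <= tnth x i) && (~~ (tnth x i <= tnth x j) || (i < j)%N).

(** The position of [i], counted from 0, when its class is listed by decreasing entries of [x]. *)
Definition rank i : nat :=
  #|[set j | (tnth a j == tnth a i) && before j i]|.

Definition top_set v m : {set 'I_n} := [set i in V v | (rank i < m)%N].
Definition top v m : R := \sum_(i in top_set v m) tnth x i.

Lemma before_irr i : before i i = false.
Proof. by rewrite /before lexx ltnn. Qed.

Lemma before_trans : transitive before.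
Proof.
move=> j i l /andP[ji /orP ij] /andP[lj /orP jl]; apply/andP; split.
  exact: le_trans lj ji.
rewrite -!ltNge in ij jl *; apply/orP.
case: ij => [ij|ij]; first by left; apply: le_lt_trans lj ij.
case: jl => [jl|jl]; first by left; apply: lt_le_trans jl ji.
by right; apply: ltn_trans ij jl.
Qed.

Lemma before_total i j : i != j -> before i j || before j i.
Proof.
rewrite /before => ne; case: (ltgtP (tnth x j) (tnth x i)) => //= _.
by rewrite -neq_ltn.
Qed.

Lemma rank_lt i j : tnth a i = tnth a j -> before i j -> (rank i < rank j)%N.
Proof.
move=> eq_a bij; apply: proper_card; apply/properP; split.
  apply/subsetP => l; rewrite !inE eq_a => /andP[-> bl].
  exact: before_trans bl bij.
by exists i; rewrite !inE ?eq_a ?eqxx // before_irr.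
Qed.

Lemma rank_class i v : i \in V v -> (rank i < #|V v|)%N.
Proof.
move=> iV; apply: proper_card; apply/properP; split.
  by apply/subsetP => j; move: iV; rewrite !inE => /eqP-> /andP[].
by exists i => //; rewrite !inE before_irr andbF.
Qed.

Lemma rank_inj v : {in V v &, injective rank}.
Proof.
move=> i j; rewrite !inE => /eqP iV /eqP jV eq_r; apply/eqP/negPn/negP.
have eq_a : tnth a i = tnth a j by rewrite iV.
move/before_total/orP => [/(rank_lt eq_a)|/(rank_lt (esym eq_a))];
by rewrite eq_r ltnn.
Qed.

Lemma before_value v i j : i \in V v -> j \in V v -> (rank i < rank j)%N ->
  tnth x j <= tnth x i.
Proof.
rewrite !inE => /eqP iV /eqP jV lt_r; rewrite leNgt; apply/negP => lt_x.
have /(rank_lt _) : before j i by rewrite /before (ltW lt_x) -ltNge lt_x.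
by rewrite iV jV => /(_ erefl) /ltn_trans/(_ lt_r); rewrite ltnn.
Qed.

Lemma card_inj_bound (A : {set 'I_n}) (f : 'I_n -> nat) m :
  {in A &, injective f} -> (forall i, i \in A -> (f i < m)%N) -> (#|A| <= m)%N.
Proof.
move=> injf hf; rewrite cardE -(size_map f) -(size_iota 0 m).
apply: uniq_leq_size.
  rewrite map_inj_in_uniq ?enum_uniq // => i j; rewrite !mem_enum; exact: injf.
move=> y /mapP[i]; rewrite mem_enum => iA ->; rewrite mem_iota; exact: hf.
Qed.

(** Ranks within a class are distinct and smaller than its size; counting them bounds both the top
    set and its complement in the class. *)
Lemma card_top_set v m : (m <= #|V v|)%N -> #|top_set v m| = m.
Proof.
move=> le_m; apply/eqP; rewrite eqn_leq; apply/andP; split.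
  apply: (@card_inj_bound _ rank) => [i j|i]; last by rewrite inE => /andP[].
  by move=> /setIdP[iV _] /setIdP[jV _]; apply: (rank_inj iV jV).
have : (#|V v :\: top_set v m| <= #|V v| - m)%N.
  apply: (@card_inj_bound _ (fun i => rank i - m)%N) => [i j|i].
    move=> /setDP[iV +] /setDP[jV +]; rewrite [_ \in _]inE [j \in top_set _ _]inE.
    rewrite iV jV /= -!leqNgt => hi hj eq_r; apply: (rank_inj iV jV).
    by rewrite -(subnK hi) eq_r subnK.
  rewrite 2!inE => /andP[+ iV]; rewrite iV /= -leqNgt => hi.
  by rewrite ltn_sub2r ?rank_class //; apply: leq_ltn_trans hi (rank_class iV).
rewrite cardsD (setIidPr _); last by apply/subsetP => i; rewrite inE => /andP[].
have : (#|top_set v m| <= #|V v|)%N.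
  by apply: subset_leq_card; apply/subsetP => i; rewrite inE => /andP[].
by move=> h1 h2; lia.
Qed.

Lemma top_set_full v : top_set v #|V v| = V v.
Proof.
apply/setP => i; rewrite [LHS]inE; case: (boolP (i \in V v)) => //= iV.
exact: rank_class.
Qed.

(** Subtract the smallest entry of the top set [T] from all entries. Both sums change equally, as
    the sets have the same size; afterwards elements of [T] contribute nonnegatively and the others
    nonpositively. *)
Lemma sum_le_top v (A : {set 'I_n}) : A \subset V v ->
  \sum_(i in A) tnth x i <= top v #|A|.
Proof.
move=> sA; have leA := subset_leq_card sA; have cT := card_top_set leA.
set T := top_set v #|A| in cT *.
have [A0|] := posnP #|A|.
  by rewrite /top -/T (cards0_eq (etrans cT A0)) (cards0_eq A0) !big_set0.
rewrite -{1}cT => /card_gt0P[i0 i0T].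
case: (Order.TotalTheory.arg_minP (fun i => tnth x i) i0T) => m mT min_m.
have hT i : i \in T -> tnth x m <= tnth x i by exact: min_m.
have hV i : i \in V v -> i \notin T -> tnth x i <= tnth x m.
  have /setIdP[mV rm] : m \in top_set v #|A| by [].
  move=> iV; rewrite inE iV /= -leqNgt => ri.
  by apply: (before_value mV iV); apply: leq_trans rm ri.
suff : \sum_(i in A) (tnth x i - tnth x m) <= \sum_(i in T) (tnth x i - tnth x m).
  by rewrite !sumrB !sumr_const cT lerD2r.
apply: (@le_trans _ _ (\sum_(i in A :&: T) (tnth x i - tnth x m))).
  rewrite (big_setID T) /= gerDl; apply: sumr_le0 => i; rewrite inE => /andP[iT iA].
  by rewrite subr_le0 hV // (subsetP sA).
rewrite [leRHS](big_setID A) /= setIC lerDl; apply: sumr_ge0 => i.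
by rewrite inE => /andP[_ iT]; rewrite subr_ge0 hT.
Qed.

(** For [p = 0] only the elements of [C :|: S] count, each once. For [p > 0] the coefficient [p - 1]
    is nonnegative, so each sum in [split_value] is replaced by its own maximum. *)
Definition class_value v (p c s : nat) : R :=
  if p == 0%N then top v (c + s)
  else top v #|V v| + (p - 1)%:R * top v (#|V v| - c) + top v s.

(** The weights 1 on [C], [p + 1] on [S] and [p] elsewhere are regrouped as 1 on the whole class,
    [p - 1] more outside [C] and 1 more on [S], so that [C] and [S] enter separate sums. *)
Definition split_value v (p : nat) C S : R :=
  \sum_(i in V v) tnth x i + (p%:R - 1) * \sum_(i in V v :\: C) tnth x i
  + \sum_(i in S :&: V v) tnth x i.

Lemma lci_lhsE C S : [disjoint C & S] -> lci_lhs a C S x =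
  \sum_(v < k) split_value v (lift_value C (w v)) C S.
Proof.
move=> dis; rewrite /lci_lhs !(big_class a) -!big_split /=.
apply: eq_bigr => v _; rewrite /split_value; set p := lift_value _ _.
have lc A (F : nat -> nat) : \sum_(i in A :&: V v) (F (lift_coef a C i))%:R * tnth x i =
    (F p)%:R * \sum_(i in A :&: V v) tnth x i.
  rewrite mulr_sumr; apply: eq_bigr => i /setIP[_ iV].
  by rewrite (lift_coefE C iV).
rewrite (lc S succn) (lc (~: (C :|: S)) id).
rewrite [\sum_(i in V v) _](big_setID C) /= [V v :&: C]setIC.
have -> : V v :\: C = V v :&: ~: C by rewrite setDE.
rewrite [\sum_(i in V v :&: ~: C) _](big_setID S) /= (_ : V v :&: ~: C :&: S = S :&: V v); last first.
  apply/setP => i; rewrite !inE; case: (boolP (i \in S)) => iS; rewrite ?andbF //.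
  by rewrite (disjointFl dis iS) /= !andbT.
rewrite (_ : V v :&: ~: C :\: S = ~: (C :|: S) :&: V v); last first.
  by apply/setP => i; rewrite !inE negb_or andbCA [RHS]andbC; do 2 case: (_ \in _).
rewrite -natr1; ring.
Qed.

Lemma sum_disjointU C S (A : {set 'I_n}) (F : 'I_n -> R) : [disjoint C & S] ->
  \sum_(i in (C :|: S) :&: A) F i =
  \sum_(i in C :&: A) F i + \sum_(i in S :&: A) F i.
Proof.
move=> dis; rewrite (big_setID C) /=; congr (_ + _); apply: eq_bigl => i;
rewrite !inE; case: (boolP (i \in C)) => iC; rewrite ?andbT ?andbF //=.
by rewrite (disjointFr dis iC).
Qed.

Lemma split_value_le v p C S : [disjoint C & S] ->
  split_value v p C S <= class_value v p (cnt C v) (cnt S v).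
Proof.
move=> dis; rewrite /split_value /class_value.
have hS : \sum_(i in S :&: V v) tnth x i <= top v (cnt S v).
  by apply: sum_le_top; apply: subsetIr.
case: eqP => [->|/eqP p0].
  rewrite (_ : (cnt C v + cnt S v)%N = #|(C :|: S) :&: V v|); last first.
    rewrite setIUl cardsU /cnt (_ : _ :&: _ :&: _ = set0) ?cards0 ?subn0 //.
    by rewrite setIACA (disjoint_setI0 dis) set0I.
  apply: le_trans (sum_le_top (subsetIr _ _)).
  rewrite [\sum_(i in V v) _](big_setID C) /= sum_disjointU //.
  rewrite [V v :&: C]setIC; lra.
rewrite /top top_set_full -/(top _ _) -/(top _ _) lerD // lerD2l.
rewrite natrB ?lt0n // ler_wpM2l ?subr_ge0 ?ler1n ?lt0n //.
rewrite (_ : (#|V v| - cnt C v)%N = #|V v :\: C|); last by rewrite cardsD setIC.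
by apply: sum_le_top; apply: subsetDl.
Qed.

(* [S] takes the largest entries of [x] in each value class; [C] takes the
   next ones where the lifting coefficient is 0 and the smallest ones
   elsewhere. *)
Lemma split_value_attained (p c s : nat -> nat) :
  (forall v, (v < k)%N -> (c v + s v <= #|V v|)%N) ->
  exists C S, [/\ [disjoint C & S],
    forall v, (v < k)%N -> cnt C v = c v,
    forall v, (v < k)%N -> cnt S v = s v &
    forall v, (v < k)%N ->
      split_value v (p v) C S = class_value v (p v) (c v) (s v)].
Proof.
move=> hcs; pose cl i := index (tnth a i) (values a).
pose S := [set i | (rank i < s (cl i))%N].
pose C := [set i | if p (cl i) == 0%N
  then (s (cl i) <= rank i < c (cl i) + s (cl i))%N
  else (#|V (cl i)| - c (cl i) <= rank i)%N].
have clV v i : (v < k)%N -> i \in V v -> cl i = v by move=> hv; rewrite mem_class // => /eqP.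
have VS v : (v < k)%N -> S :&: V v = top_set v (s v).
  move=> hv; apply/setP => i; rewrite in_setI [in RHS]inE andbC.
  by case: (boolP (i \in V v)) => //= iV; rewrite inE (clV v).
have VCS v : (v < k)%N -> p v = 0%N -> (C :|: S) :&: V v = top_set v (c v + s v).
  move=> hv p0; apply/setP => i; rewrite in_setI [in RHS]inE andbC.
  case: (boolP (i \in V v)) => //= iV; rewrite !inE (clV v) // p0 eqxx.
  by have := hcs v hv; lia.
have VC v : (v < k)%N -> p v != 0%N -> V v :\: C = top_set v (#|V v| - c v).
  move=> hv p0; apply/setP => i; rewrite in_setD [in RHS]inE andbC.
  by case: (boolP (i \in V v)) => //= iV; rewrite !inE (clV v) // (negbTE p0) -ltnNge.
(* Where [p > 0], [S] takes the first [s] ranks and [C] the last [c]; they do not meet because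
   [c + s] is at most the size of the class. *)
have dis : [disjoint C & S].
  rewrite -setI_eq0; apply/eqP/setP => i; rewrite !inE.
  have := hcs _ (class_lt a i); rewrite -/(cl i).
  have : (rank i < #|V (cl i)|)%N by apply: rank_class; rewrite mem_class // class_lt.
  by case: eqP => _; lia.
have cS v : (v < k)%N -> cnt S v = s v.
  by move=> hv; rewrite /class_card VS // card_top_set //; have := hcs v hv; lia.
exists C, S; split=> // v hv.
  have h := hcs v hv; have [p0|p0] := eqVneq (p v) 0%N.
    have := congr1 (fun A : {set _} => #|A|) (VCS v hv p0).
    rewrite card_top_set // setIUl cardsU -/(cnt C v) -/(cnt S v) cS //.
    rewrite setIACA (disjoint_setI0 dis) set0I cards0; lia.
  have := congr1 (fun A : {set _} => #|A|) (VC v hv p0).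
  rewrite card_top_set ?leq_subr // cardsD setIC -/(cnt C v).
  by have := class_card_le a C v; lia.
rewrite /split_value /class_value VS //; have [p0|p0] := eqVneq (p v) 0%N.
  rewrite /top -VCS // sum_disjointU //.
  rewrite [\sum_(i in V v) _](big_setID C) /= [V v :&: C]setIC VS // p0; ring.
by rewrite VC // /top top_set_full natrB ?lt0n.
Qed.

Lemma lci_lhs_le C S : [disjoint C & S] -> lci_lhs a C S x <=
  \sum_(v < k) class_value v (lift_value C (w v)) (cnt C v) (cnt S v).
Proof.
by move=> dis; rewrite lci_lhsE //; apply: ler_sum => v _; apply: split_value_le.
Qed.

End Value.
End Lifting.

(** * The program *)

Declare Scope nexp_scope.
Delimit Scope nexp_scope with nexp.
Bind Scope nexp_scope with nexp.
Declare Scope rexp_scope.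
Delimit Scope rexp_scope with rexp.
Bind Scope rexp_scope with rexp.
Coercion NConst : nat >-> nexp.
Coercion ROfNat : nexp >-> rexp.
Notation "x + y" := (NAdd x y) : nexp_scope.
Notation "x - y" := (NSub x y) : nexp_scope.
Notation "x * y" := (NMul x y) : nexp_scope.
Notation "A .[ e ]" := (NGet A e%nexp) : nexp_scope.
Notation "x + y" := (RAdd x y) : rexp_scope.
Notation "x - y" := (RSub x y) : rexp_scope.
Notation "x * y" := (RMul x y) : rexp_scope.
Notation "A .[ e ]" := (RGet A e%nexp) : rexp_scope.
(* Subtraction is truncated, so this is 1 if [x <= y] and 0 otherwise. *)
Notation "[ 'le' x , y ]" := (NSub (NConst 1) (NSub x%nexp y%nexp)) (at level 0) : nexp_scope.
Notation "[ 'le' x , y ]" := (ROfNat (NSub (NConst 1) (NSub x%nexp y%nexp))) (at level 0) : rexp_scope.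
Notation "c1 ;; c2" := (SSeq c1 c2) (at level 90, right associativity).

(* Arrays of naturals; [vSize] also holds [beta] in its cell 1. *)
Local Notation vSize := 0 (only parsing).
Local Notation vA := 1 (only parsing).
Local Notation vAns := 2 (only parsing).
Local Notation vB := 3 (only parsing).
Local Notation vK := 4 (only parsing).
Local Notation vM := 5 (only parsing).
Local Notation vPow := 6 (only parsing).
Local Notation vW := 7 (only parsing).
Local Notation vQ := 8 (only parsing).
Local Notation vCard := 9 (only parsing).
Local Notation vRank := 10 (only parsing).
Local Notation vI := 11 (only parsing).
Local Notation vJ := 12 (only parsing).
Local Notation vL := 13 (only parsing).
Local Notation vPrev := 14 (only parsing).
Local Notation vMax := 15 (only parsing).
Local Notation vT := 16 (only parsing).
Local Notation vU := 17 (only parsing).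
Local Notation vZC := 18 (only parsing).
Local Notation vZ := 19 (only parsing).
Local Notation vV := 20 (only parsing).
Local Notation vCur := 21 (only parsing).
Local Notation vC := 22 (only parsing).
Local Notation vWC := 23 (only parsing).
Local Notation vSC := 24 (only parsing).
Local Notation vBad := 25 (only parsing).
Local Notation vH := 26 (only parsing).
Local Notation vMu := 27 (only parsing).
Local Notation vPi := 28 (only parsing).
Local Notation vD := 29 (only parsing).
Local Notation vWS := 30 (only parsing).
Local Notation vHS := 31 (only parsing).
Local Notation vBadS := 32 (only parsing).
Local Notation vTab := 33 (only parsing).
Local Notation rX := 0 (only parsing).
Local Notation rTop := 1 (only parsing).
Local Notation rVal := 2 (only parsing).

Local Notation put A e := (SN A (NConst 0) e%nexp).

(** Under truncated subtraction [m + (p - m)] is the maximum of [m] and [p]; the flag replaces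
    coefficients not below [vPrev] by 0. *)
Definition max_loop : scmd :=
  SFor vJ vSize (put vMax (cell vMax +
     (vA.[cell vJ] * [le vA.[cell vJ] + 1, cell vPrev] - cell vMax))).

(** Each round selects the largest coefficient below the one selected before, starting from
    [beta + 1], which exceeds them all. Since coefficients are positive, a maximum of 0 means that
    the values are exhausted. *)
Definition find_values : scmd :=
  put vB (cell vSize + 1) ;;
  put vPrev (vSize.[1] + 1) ;;
  SFor vI vSize (
    put vMax 0 ;;
    max_loop ;;
    SN vW (cell vI) (cell vMax) ;;
    put vPrev (cell vMax) ;;
    put vK (cell vK + [le 1, cell vMax])).

Definition find_powers : scmd :=
  put vPow 1 ;;
  SFor vV vK (SN vPow (cell vV + 1) (vPow.[cell vV] * cell vB)) ;;
  put vM (vPow.[cell vK]).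

(* The machine cannot divide: [z %/ B] is tabulated from
   [(z + B) %/ B = (z %/ B).+1]. *)
Definition quotients : scmd :=
  SFor vZ vM (SN vQ (cell vZ + cell vB) (vQ.[cell vZ] + 1)).

(** The product of the two opposite comparisons is the flag for equality. *)
Definition card_loop : scmd :=
  SFor vI vSize (SN vCard (cell vV) (vCard.[cell vV] +
    [le vA.[cell vI], vW.[cell vV]] * [le vW.[cell vV], vA.[cell vI]])).

Definition class_cards : scmd :=
  SFor vV vK (SN vCard (cell vV) 0 ;; card_loop).

(** The last factor is the flag of [before j i]: the product stands for the conjunction, and the sum
    compared with 1 for the disjunction. *)
Definition rank_loop : scmd :=
  SFor vJ vSize (
    SLe vT (rX.[cell vI])%rexp (rX.[cell vJ])%rexp ;;
    SLe vU (rX.[cell vJ])%rexp (rX.[cell vI])%rexp ;;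
    SN vRank (cell vI) (vRank.[cell vI] +
      [le vA.[cell vJ], vA.[cell vI]] * [le vA.[cell vI], vA.[cell vJ]] *
      (cell vT * [le 1, (1 - cell vU) + [le cell vJ + 1, cell vI]]))).

Definition ranks : scmd :=
  SFor vI vSize (SN vRank (cell vI) 0 ;; rank_loop).

Definition top_loop : scmd :=
  SFor vI vSize (SR rTop (cell vV * cell vB + cell vL)
    (rTop.[cell vV * cell vB + cell vL] +
      ROfNat ([le vA.[cell vI], vW.[cell vV]] * [le vW.[cell vV], vA.[cell vI]] *
       [le vRank.[cell vI] + 1, cell vL]) * rX.[cell vI])%rexp).

(** A two-dimensional table stored by rows: row [v] has [B = n + 1] entries, one for each number of
    summands from 0 to [n]. *)
Definition tops : scmd :=
  SFor vV vK (SFor vL vB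
    (SR rTop (cell vV * cell vB + cell vL)%nexp (ROfNat 0) ;; top_loop)).

(** [vCur] loses its lowest digit in each round; the digit is the remainder obtained from the
    tabulated quotient. *)
Definition cover_loop : scmd :=
  SFor vV vK (
    SN vC (cell vV) (cell vCur - vQ.[cell vCur] * cell vB) ;;
    put vCur (vQ.[cell vCur]) ;;
    put vWC (cell vWC + vC.[cell vV] * vW.[cell vV]) ;;
    put vSC (cell vSC + vC.[cell vV])).

Definition minimal_loop : scmd :=
  SFor vV vK (put vBad (cell vBad +
    [le 1, vC.[cell vV]] * [le vSize.[1] + vW.[cell vV] + 1, cell vWC])).

(* The cell above [vH] may hold garbage; it is overwritten or never read. *)
Definition mu_inner_loop : scmd :=
  SFor vJ vSize (
    SN vMu (cell vH + 1) (vMu.[cell vH] + vW.[cell vV]) ;;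
    put vH (cell vH + [le cell vJ + 1, vC.[cell vV]])).

Definition mu_loop : scmd := SFor vV vK mu_inner_loop.

(** The candidates [h] run up to [n]; the flag for [h <= #|C|] discards those for which the table of
    [mu] may be stale. *)
Definition lift_inner_loop : scmd :=
  SFor vJ vB (SN vPi (cell vV) (vPi.[cell vV] +
    (cell vJ * ([le cell vJ, cell vSC] * [le vMu.[cell vJ], vW.[cell vV]])
     - vPi.[cell vV]))).

Definition lift_loop : scmd :=
  SFor vV vK (SN vPi (cell vV) 0 ;; lift_inner_loop).

Definition next_digit : scmd :=
  put vD (cell vCur - vQ.[cell vCur] * cell vB) ;;
  put vCur (vQ.[cell vCur]).

(** If the digit is 0, the truncated address [z - B ^ v] does not belong to a smaller set; the flag
    for a positive digit cancels what is read there. *)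
Definition independent_loop : scmd :=
  SFor vV vK (
    next_digit ;;
    put vWS (cell vWS + cell vD * vW.[cell vV]) ;;
    put vHS (cell vHS + cell vD * (vPi.[cell vV] + 1)) ;;
    put vBadS (cell vBadS +
      [le 1, cell vD] * (1 - vTab.[cell vZ - vPow.[cell vV]]))).

(* [S] is independent iff it satisfies its own inequality and every
   [S :\ i], whose code is that of [S] minus a power of the base, is
   independent. *)
Definition independent_table : scmd :=
  SFor vZ vM (
    put vCur (cell vZ) ;;
    put vWS 0 ;; put vHS 0 ;; put vBadS 0 ;;
    independent_loop ;;
    SN vTab (cell vZ) ([le cell vBadS, 0] *
      [le vMu.[cell vHS - (cell vHS - cell vSC)] + vSize.[1] + 1,
          cell vWS + cell vWC])).

Definition violation_loop : scmd :=
  SFor vV vK (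
    next_digit ;;
    put vBadS (cell vBadS +
      ([le vCard.[cell vV] + 1, vC.[cell vV] + cell vD] +
       [le vC.[cell vV] + cell vD + 1, vCard.[cell vV]] *
       vTab.[cell vZ + vPow.[cell vV]])) ;;
    SR rVal 0 (rVal.[0] +
      ([le vPi.[cell vV], 0] * rTop.[cell vV * cell vB + (vC.[cell vV] + cell vD)] +
       [le 1, vPi.[cell vV]] *
         (rTop.[cell vV * cell vB + vCard.[cell vV]] +
          ROfNat (vPi.[cell vV] - 1) *
            rTop.[cell vV * cell vB + (vCard.[cell vV] - vC.[cell vV])] +
          rTop.[cell vV * cell vB + cell vD])))%rexp).

(** As [vBadS] starts from [vBad], one test for 0 checks minimality of [C], realisability of the
    counts and the impossibility of enlarging [S]; the table supplies independence of [S] itself. *)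
Definition violations : scmd :=
  SFor vZ vM (
    put vCur (cell vZ) ;;
    put vBadS (cell vBad) ;;
    SR rVal 0 (ROfNat 0) ;;
    violation_loop ;;
    SLe vT (rVal.[0])%rexp (ROfNat (cell vSC) - ROfNat 1)%rexp ;;
    put vAns (cell vAns + (1 - cell vT) * ([le cell vBadS, 0] * vTab.[cell vZ]))).

Definition cover_data : scmd :=
    put vCur (cell vZC) ;; put vWC 0 ;; put vSC 0 ;;
    cover_loop ;;
    put vBad [le cell vWC, vSize.[1]] ;;
    minimal_loop ;;
    put vMu 0 ;; put vH 0 ;;
    mu_loop ;;
    lift_loop.

Definition separate : scmd :=
  SFor vZC vM (cover_data ;; independent_table ;; violations).

Definition find_tables : scmd := quotients ;; class_cards ;; ranks ;; tops.

Definition solve : scmd := find_tables ;; separate.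

(** * Correctness of the program *)

Lemma le_flag m p : 1 - (m - p) = (m <= p).
Proof. by case: leqP; lia. Qed.

Lemma eq_flag m p : (m <= p) * (p <= m) = (m == p).
Proof. by rewrite mulnb -eqn_leq. Qed.

Lemma max_flag m p : m + (p - m) = maxn m p.
Proof. by rewrite maxnE. Qed.

(** * Distinct coefficients and powers of the base *)

Section Values.
Variables (R : realType) (n : nat) (a : n.-tuple nat) (beta : nat).
Implicit Types (s : state R) (v t j : nat).
Local Notation k := (size (values a)).
Local Notation w := (nth 0 (values a)).
Hypothesis a_bounds : forall i : 'I_n, 0 < tnth a i <= beta.

Lemma k_le_n : k <= n.
Proof. by rewrite size_values -[leqRHS](size_tuple a) size_undup. Qed.

Lemma w_attained v : v < k -> exists i, w v = tnth a i.
Proof.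
move=> lt_v; have : w v \in tval a by rewrite -mem_values mem_nth.
by move/tnthP.
Qed.

Lemma w_gt0 v : (0 < w v) = (v < k).
Proof.
case: (ltnP v k) => [lt_v|le_v]; last by rewrite nth_default.
by have [i ->] := w_attained lt_v; case/andP: (a_bounds i).
Qed.

Lemma w_anti u v : u < v -> v < k -> w v < w u.
Proof.
move=> lt_uv lt_v; have lt_u := ltn_trans lt_uv lt_v.
rewrite ltn_neqAle nth_uniq ?values_uniq // gtn_eqF //=.
have := values_sorted a; rewrite sorted_pairwise; last first.
  by move=> y x z /= h1 h2; apply: leq_trans h2 h1.
by move/(pairwiseP 0); apply.
Qed.

(** The entry at [t] of the list with [beta.+1] in front is the value preceding [w t], and [values]
    is strictly decreasing. Past the end both sides are the default 0. *)
Lemma next_value t : \max_(i < n) (nth 0 a i * (nth 0 a i < nth 0 (beta.+1 :: values a) t)) =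
  w t.
Proof.
apply/eqP; rewrite eqn_leq; apply/andP; split.
  apply/bigmax_leqP => i _; rewrite -tnth_nth; case: ltnP => [lt_a|]; last by rewrite muln0.
  rewrite muln1; have lt_u := class_lt a i.
  have eu : w (index (tnth a i) (values a)) = tnth a i.
    by rewrite nth_index // mem_values mem_tnth.
  move: lt_u eu; set u := index _ _ => lt_u eu; rewrite -eu.
  have [lt_ut|] := ltnP u t; last first.
    by rewrite leq_eqVlt => /orP[/eqP->|/w_anti/(_ lt_u)/ltnW].
  case: t lt_a lt_ut => // t; rewrite /= -eu ltnS => lt_a; rewrite leq_eqVlt => /orP[/eqP eut|lt_ut].
    by rewrite eut ltnn in lt_a.
  have [lt_t|le_t] := ltnP t k; last by rewrite (nth_default _ le_t) ltn0 in lt_a.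
  by have := ltn_trans lt_a (w_anti lt_ut lt_t); rewrite ltnn.
have [lt_t|le_t] := ltnP t k; last by rewrite nth_default.
have [i ei] := w_attained lt_t.
apply: leq_trans (leq_bigmax i); rewrite -tnth_nth -ei.
suff -> : w t < nth 0 (beta.+1 :: values a) t by rewrite muln1.
case: t lt_t ei => [_ ->|t lt_t _] /=; first by rewrite ltnS; case/andP: (a_bounds i).
exact: w_anti.
Qed.

Lemma run_max_loop s : nmem s vSize 0 = n -> nmem s vA = nth 0 a ->
  nmem s vMax 0 = 0 ->
  nmem (run max_loop s) vMax 0 = \max_(i < n) (nth 0 a i * (nth 0 a i < nmem s vPrev 0)).
Proof.
move=> hn ha h0.
pose Inv j s' := nmem s' vMax 0 =
  \max_(i < j) (nth 0 a i * (nth 0 a i < nmem s vPrev 0)).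
apply: (run_for_ind (Inv := Inv) hn); rewrite /Inv //.
  by rewrite big_ord0.
move=> j s' lt_j En _ IH; rewrite big_ord_recr /= -IH run_SN /=.
by rewrite (En 1) // (En 14) // ha le_flag max_flag addn1.
Qed.

Lemma run_find_values s : nmem s vSize 0 = n -> nmem s vSize 1 = beta ->
  nmem s vA = nth 0 a -> nmem s vK 0 = 0 ->
  let s' := run find_values s in
  [/\ nmem s' vB 0 = n.+1, nmem s' vK 0 = k & forall v, v < k -> nmem s' vW v = w v].
Proof.
move=> hn hb ha hk.
rewrite /find_values run_seq; set s1 := run (SN 3 _ _) s.
rewrite run_seq; set s2 := run (SN 14 _ _) s1.
have ha2 : nmem s2 vA = nth 0 a by rewrite /s2 run_SN /= /s1 run_SN.
have hn2 : nmem s2 vSize 0 = n by rewrite /s2 run_SN /= /s1 run_SN.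
(* There are [n] rounds, as [k] is not known beforehand; the count stops at [k] because later maxima
   are 0. *)
pose Inv j (s' : state R) := [/\ nmem s' vPrev 0 = nth 0 (beta.+1 :: values a) j,
  nmem s' vK 0 = minn j k & forall v, v < j -> nmem s' vW v = w v].
set b := SFor _ _ _.
have : Inv n (run b s2).
  apply: run_for_ind; rewrite {}/b //.
    by split; rewrite // /s2 run_SN /= /s1 run_SN /= ?hb ?addn1 ?min0n.
  move=> j s' lt_j En _ [hp hK hW].
  rewrite !run_seq; set s3 := run (SN 15 _ _) _.
  have hm : nmem (run max_loop s3) vMax 0 = w j.
    rewrite run_max_loop; rewrite /s3 ?run_SN /= ?(En 0) ?(En 1) //.
    by rewrite hp next_value.
  set s4 := run max_loop s3 in hm |- *.
  have fr A : A \notin [:: 12; 15; 11] -> nmem s4 A = nmem s' A.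
    rewrite !inE !negb_or => /and3P[h12 h15 h11].
    rewrite /s4 run_nframe; last by rewrite /= !inE negb_or h12.
    by rewrite /s3 run_SN /= (negbTE h15) (negbTE h11).
  have e4 : nmem s4 11 0 = j by rewrite /s4 run_nframe.
  rewrite /Inv !run_SN /= !e4 hm (fr 4) // (fr 7) // hK le_flag w_gt0; split=> //.
    by case: ltnP; lia.
  move=> v; rewrite ltnS leq_eqVlt; case: eqP => [->//|_ /= lt_v].
  exact: hW.
case=> _ hK hW; split.
- by rewrite run_nframe // /s2 run_SN /= /s1 run_SN /= hn addn1.
- by rewrite hK; apply/minn_idPr/k_le_n.
- by move=> v lt_v; apply: hW; apply: leq_trans lt_v k_le_n.
Qed.

Lemma run_find_powers s B : nmem s vB 0 = B -> nmem s vK 0 = k ->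
  let s' := run find_powers s in
  (forall v, v <= k -> nmem s' vPow v = B ^ v) /\ nmem s' vM 0 = B ^ k.
Proof.
move=> hB hk; rewrite /find_powers run_seq; set s1 := run (SN 6 _ _) s.
rewrite run_seq.
pose Inv j (s' : state R) := forall v, v <= j -> nmem s' vPow v = B ^ v.
set b := SFor _ _ _.
have hI : Inv k (run b s1).
  apply: run_for_ind; rewrite {}/b //.
    by move=> v; rewrite leqn0 => /eqP->.
  move=> j s' lt_j En _ IH v; rewrite leq_eqVlt run_SN /= addn1 (En 3) //=.
  by case: eqP => [-> _|_ /= lt_v]; rewrite ?IH // expnSr /s1 run_SN /= hB.
have ek : nmem (run b s1) 4 0 = k by rewrite run_nframe // /s1 run_SN.
by rewrite run_SN /=; split=> [v|]; rewrite ?ek; apply: hI.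
Qed.

End Values.

(** * Tables that do not depend on the cover *)

Section Tables.
Variables (R : realType) (n : nat) (a : n.-tuple nat) (beta : nat).
Variable x : n.-tuple R.
Implicit Types (s : state R) (v t j z : nat).
Local Notation k := (size (values a)).
Local Notation w := (nth 0 (values a)).
Local Notation B := n.+1.
Local Notation M := (n.+1 ^ size (values a)).
Local Notation V := (value_class a).

Record parameters s : Prop := ParametersOf {
  par_n : nmem s vSize 0 = n;
  par_beta : nmem s vSize 1 = beta;
  par_a : nmem s vA = nth 0 a;
  par_B : nmem s vB 0 = B;
  par_K : nmem s vK 0 = k;
  par_M : nmem s vM 0 = M;
  par_pow : forall v, v <= k -> nmem s vPow v = B ^ v;
  par_w : forall v, v < k -> nmem s vW v = w v }.

Lemma parametersW s s' : agree [:: vSize; vA; vB; vK; vM; vPow; vW] s s' ->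
  parameters s -> parameters s'.
Proof. by move=> E [? ? ? ? ? ? ? ?]; split; rewrite E. Qed.

Record tables s : Prop := Tables {
  tab_par :> parameters s;
  tab_quo : forall z, z < M -> nmem s vQ z = z %/ B;
  tab_card : forall v, v < k -> nmem s vCard v = #|V v|;
  tab_top : forall v m, v < k -> m < B ->
    rmem s rTop (v * B + m) = top a x v m }.

Definition table_arrays := [:: vSize; vA; vB; vK; vM; vPow; vW; vQ; vCard].

Lemma tablesW s s' : agree table_arrays s s' -> rmem s' rTop = rmem s rTop ->
  tables s -> tables s'.
Proof.
move=> E Er [hp hq hc ht]; split; rewrite ?E ?Er //.
by apply: parametersW hp => A hA; apply: E; move: A hA; apply/allP.
Qed.

Lemma run_quotients s : parameters s -> (forall z, nmem s vQ z = 0) ->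
  forall z, z < M -> nmem (run quotients s) vQ z = z %/ B.
Proof.
move=> par h0.
(* Round [j] fills cell [j + B]; the first [B] cells are correct from the start, since they hold
   0. *)
pose Inv j (s' : state R) := forall z, z < j + B -> nmem s' vQ z = z %/ B.
have hI : Inv M (run quotients s).
  apply: (run_for_ind (Inv := Inv) (par_M par)); rewrite /Inv //.
    by move=> z lt_z; rewrite h0 divn_small.
  move=> j s' lt_j En _ IH z lt_z; rewrite run_SN /= (En 3) // (par_B par).
  case: eqP => [->|/= ne]; last by apply: IH; lia.
  by rewrite IH ?divnDr ?divnn //; lia.
by move=> z lt_z; apply: hI; lia.
Qed.

Lemma run_card_loop s v : parameters s -> v < k -> nmem s vV 0 = v ->
  nmem s vCard v = 0 ->
  nmem (run card_loop s) vCard =1 [eta nmem s vCard with v |-> #|V v|].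
Proof.
move=> par lt_v hv h0.
pose Inv j (s' : state R) :=
  nmem s' vCard =1 [eta nmem s vCard with v |-> \sum_(i < j) (nth 0 a i == w v)].
have hI : Inv n (run card_loop s).
  apply: (run_for_ind (Inv := Inv) (par_n par)); rewrite /Inv //.
    by move=> u /=; rewrite big_ord0; case: eqP => // ->.
  move=> j s' lt_j En _ IH u; rewrite run_SN /= big_ord_recr /=.
  rewrite !(En 20) // hv (En 1) // (En 7) // par_w // (par_a par) !le_flag eq_flag.
  by rewrite !IH /= eqxx; case: eqP.
move=> u; rewrite hI /=; case: eqP => // _.
rewrite -sum1_card [RHS]big_mkcond; apply: eq_bigr => i _.
by rewrite inE (tnth_nth 0); case: eqP.
Qed.

Lemma run_class_cards s : parameters s ->
  forall v, v < k -> nmem (run class_cards s) vCard v = #|V v|.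
Proof.
move=> par.
pose Inv j (s' : state R) := forall v, v < j -> nmem s' vCard v = #|V v|.
apply: (run_for_ind (Inv := Inv) (par_K par)); rewrite /Inv //.
move=> j s' lt_j En _ IH v; rewrite ltnS leq_eqVlt => lt_v.
rewrite run_seq (@run_card_loop _ j); rewrite ?run_SN //=.
- by case: eqP lt_v => [->//|_ /= /IH].
- apply: parametersW par; apply: agree_trans (agree_frame En _) _ => //.
  by move=> A; rewrite !inE; do ![case/orP]; move/eqP->.
- by rewrite eqxx.
Qed.

Lemma run_rank_loop s (i : 'I_n) : parameters s -> rmem s rX = nth 0%R x ->
  nmem s vI 0 = i -> nmem s vRank i = 0 ->
  nmem (run rank_loop s) vRank =1 [eta nmem s vRank with nat_of_ord i |-> rank a x i].
Proof.
move=> par hx hi h0.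
pose bf j := ((nth 0 x i <= nth 0 x j) && (~~ (nth 0 x j <= nth 0 x i) || (j < i)%N))%R.
pose Inv j (s' : state R) := nmem s' vRank =1
  [eta nmem s vRank with nat_of_ord i |-> \sum_(l < j) ((nth 0 a l == nth 0 a i) && bf l)].
have hI : Inv n (run rank_loop s).
  apply: (run_for_ind (Inv := Inv) (par_n par)); rewrite /Inv //.
    by move=> u /=; rewrite big_ord0; case: eqP => // ->.
  move=> j s' lt_j En Er IH u; rewrite !run_seq !run_SLe run_SN /= big_ord_recr /=.
  rewrite !(En 11) // hi (En 1) // (par_a par) !Er // hx !le_flag eq_flag.
  rewrite !IH /= eqxx; case: eqP => //= _; congr (_ + _).
  rewrite -mulnb /bf addn1; congr (_ * _).
  by do 2 case: (_ <= _)%R => //=; case: (j < i).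
move=> u; rewrite hI /=; case: eqP => // _.
rewrite /rank -sum1_card [RHS]big_mkcond; apply: eq_bigr => j _.
by rewrite inE /before !(tnth_nth 0) !(tnth_nth 0%R) /bf; case: (_ && _).
Qed.

Lemma run_ranks s : parameters s -> rmem s rX = nth 0%R x ->
  forall i : 'I_n, nmem (run ranks s) vRank i = rank a x i.
Proof.
move=> par hx.
pose Inv j (s' : state R) := forall i : 'I_n, i < j -> nmem s' vRank i = rank a x i.
suff hI : Inv n (run ranks s) by move=> i; apply: hI.
apply: (run_for_ind (Inv := Inv) (par_n par)); rewrite /Inv //.
move=> j s' lt_j En Er IH i; rewrite ltnS leq_eqVlt => lt_i.
rewrite run_seq (@run_rank_loop _ (Ordinal lt_j)); rewrite ?run_SN /= ?Er ?eqxx //.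
- case: eqP lt_i => [e _|_ /= /IH //].
  by congr rank; apply: val_inj; rewrite /= e.
- apply: parametersW par; apply: agree_trans (agree_frame En _) _ => //.
  by move=> A; rewrite !inE; do ![case/orP]; move/eqP->.
Qed.

Lemma run_top_loop s v m : parameters s -> rmem s rX = nth 0%R x ->
  (forall i : 'I_n, nmem s vRank i = rank a x i) ->
  v < k -> nmem s vV 0 = v -> nmem s vL 0 = m ->
  rmem s rTop (v * B + m) = 0%R ->
  rmem (run top_loop s) rTop =1 [eta rmem s rTop with v * B + m |-> top a x v m].
Proof.
move=> par hx hr lt_v hv hm h0.
pose f (i : nat) := ((((nth 0 a i == w v) * (nmem s vRank i < m))%:R) * nth 0 x i)%R.
pose Inv j (s' : state R) := rmem s' rTop =1
  [eta rmem s rTop with v * B + m |-> (\sum_(i < j) f i)%R].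
have hI : Inv n (run top_loop s).
  apply: (run_for_ind (Inv := Inv) (par_n par)); rewrite /Inv //.
    by move=> u /=; rewrite big_ord0; case: eqP => // ->.
  move=> j s' lt_j En Er IH u; rewrite run_SR /= big_ord_recr /=.
  rewrite !(En 20) // !(En 13) // !(En 3) // !(En 1) // !(En 7) // !(En 10) // hv hm.
  rewrite !(par_B par) !(par_a par) !(par_w par) // (Er 0) // hx !le_flag eq_flag addn1.
  by rewrite !IH /= eqxx; case: eqP.
move=> u; rewrite hI /=; case: eqP => // _.
rewrite /top [RHS]big_mkcond /=; apply: eq_bigr => i _.
rewrite /f hr !inE (tnth_nth 0) (tnth_nth 0%R).
by case: eqP => _; case: (_ < _); rewrite ?mul1r ?mul0r.
Qed.

Lemma run_tops s : parameters s -> rmem s rX = nth 0%R x ->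
  (forall i : 'I_n, nmem s vRank i = rank a x i) ->
  forall v m, v < k -> m < B -> rmem (run tops s) rTop (v * B + m) = top a x v m.
Proof.
move=> par hx hr.
pose Inv j (s' : state R) := forall v m, v < j -> m < B ->
  rmem s' rTop (v * B + m) = top a x v m.
suff hI : Inv k (run tops s) by move=> v m; apply: hI.
apply: (run_for_ind (Inv := Inv) (par_K par)); rewrite /Inv //.
move=> j s' lt_j En Er IH v m; rewrite ltnS leq_eqVlt => lt_v lt_m.
set b := SFor vL _ _; set s1 := nset s' 20 j.
have par1 : parameters s1.
  apply: parametersW par; apply: agree_trans (agree_frame En _) _ => //.
  by move=> A; rewrite !inE; do ![case/orP]; move/eqP->.
pose Inv2 l (s2 : state R) := forall v m, m < B -> (v < j) || (v == j) && (m < l) ->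
  rmem s2 rTop (v * B + m) = top a x v m.
suff hI : Inv2 B (run b s1).
  by apply: hI => //; rewrite lt_m andbT orbC.
apply: (run_for_ind (Inv := Inv2) (par_B par1)); rewrite /Inv2 //.
  by move=> {lt_v lt_m}v {}m lt_m; rewrite andbF orbF => lt_v; apply: IH.
move=> l s2 lt_l En2 Er2 IH2 {lt_v lt_m}v {}m lt_m hvm.
rewrite run_seq; set s3 := run (SR _ _ _) _.
have hB : nmem s2 3 0 = B by rewrite En2 // (par_B par1).
have hj : nmem s2 20 0 = j by rewrite En2.
have par3 : parameters s3.
  apply: parametersW par1; apply: agree_trans (agree_frame En2 _) _ => //.
  by move=> A; rewrite /s3 run_SR !inE; do ![case/orP]; move/eqP->.
rewrite (@run_top_loop s3 j l) // /s3 ?run_SR /= ?hj ?hB ?eqxx //.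
- case: eqP => [e|ne].
    (* An address [v * B + m] with [m < B] determines [v] and [m], so no other entry of the table is
       touched. *)
    by have [-> ->] : v = j /\ m = l by nia.
  apply: IH2 => //; case/orP: hvm => [->//|/andP[/eqP ev]].
  rewrite ltnS leq_eqVlt ev eqxx /= => /orP[/eqP em|->]; rewrite ?orbT //.
  by case: ne; rewrite ev em.
- by rewrite Er2 // Er.
- by move=> i; rewrite En2 //= En.
Qed.

Lemma run_find_tables s : parameters s -> rmem s rX = nth 0%R x ->
  (forall z, nmem s vQ z = 0) -> tables (run find_tables s).
Proof.
move=> par hx h0; rewrite /find_tables !run_seq.
set s1 := run quotients s; set s2 := run class_cards s1; set s3 := run ranks s2.
have par1 : parameters s1 by apply: parametersW par; apply: agree_run.
have par2 : parameters s2 by apply: parametersW par1; apply: agree_run.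
have par3 : parameters s3 by apply: parametersW par2; apply: agree_run.
have hx2 : rmem s2 rX = nth 0%R x by rewrite /s2 run_rframe // /s1 run_rframe.
have hx3 : rmem s3 rX = nth 0%R x by rewrite /s3 run_rframe.
split.
- by apply: parametersW par3; apply: agree_run.
- move=> z lt_z; rewrite 3?run_nframe //; exact: run_quotients.
- move=> v lt_v; rewrite 2?run_nframe //; exact: run_class_cards.
- move=> v m lt_v lt_m; apply: run_tops => //; exact: run_ranks.
Qed.

End Tables.

(** * Data of a cover computed from its code *)

Section CoverData.
Variables (R : realType) (n : nat) (a : n.-tuple nat) (beta : nat).
Variable x : n.-tuple R.
Implicit Types (s : state R) (v t j z : nat) (C S : {set 'I_n}).
Local Notation k := (size (values a)).
Local Notation w := (nth 0 (values a)).
Local Notation B := n.+1.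
Local Notation M := (n.+1 ^ size (values a)).
Local Notation V := (value_class a).
Local Notation cnt := (class_card a).
Local Notation tables := (tables a beta x).

Lemma divn_expnS z v : z %/ B ^ v.+1 = z %/ B ^ v %/ B.
Proof. by rewrite expnSr divnMA. Qed.

Lemma sub_divn_digit z v : z %/ B ^ v - z %/ B ^ v %/ B * B = digit B z v.
Proof. by rewrite {1}(divn_eq (z %/ B ^ v) B) addKn. Qed.

Lemma quo_lt z v : z < M -> z %/ B ^ v < M.
Proof. by apply: leq_ltn_trans; apply: leq_div. Qed.

Lemma run_cover_loop s z : tables s -> z < M ->
  nmem s vCur 0 = z -> nmem s vWC 0 = 0 -> nmem s vSC 0 = 0 ->
  let s' := run cover_loop s in
  [/\ forall v, v < k -> nmem s' vC v = digit B z v,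
      nmem s' vWC 0 = \sum_(v < k) digit B z v * w v
    & nmem s' vSC 0 = \sum_(v < k) digit B z v].
Proof.
move=> ts lt_z hz hW hS.
pose Inv j (s' : state R) := [/\ nmem s' vCur 0 = z %/ B ^ j,
  forall v, v < j -> nmem s' vC v = digit B z v,
  nmem s' vWC 0 = \sum_(v < j) digit B z v * w v
  & nmem s' vSC 0 = \sum_(v < j) digit B z v].
suff : Inv k (run cover_loop s) by case.
apply: (run_for_ind (Inv := Inv) (par_K ts)) => //.
  by rewrite /Inv !big_ord0 divn1.
move=> j s' lt_j En _ [IHq IHc IHW IHS].
rewrite !run_seq !run_SN /Inv !big_ord_recr /= !eqxx.
rewrite (En 8) // (En 3) // (En 7) // (par_B ts) (par_w ts) // IHq (tab_quo ts) ?quo_lt //.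
rewrite sub_divn_digit divn_expnS IHW IHS; split=> //.
by move=> v; rewrite ltnS leq_eqVlt; case: eqP => [->|_ /= /IHc].
Qed.

Lemma run_minimal_loop s : tables s ->
  nmem (run minimal_loop s) vBad 0 = nmem s vBad 0 +
    \sum_(v < k) ((0 < nmem s vC v) && (beta + w v < nmem s vWC 0)).
Proof.
move=> ts.
pose Inv j (s' : state R) := nmem s' vBad 0 = nmem s vBad 0 +
    \sum_(v < j) ((0 < nmem s vC v) && (beta + w v < nmem s vWC 0)).
apply: (run_for_ind (Inv := Inv) (par_K ts)) => //.
  by rewrite /Inv big_ord0 addn0.
move=> j s' lt_j En _ IH; rewrite /Inv big_ord_recr run_SN /= IH -addnA.
rewrite (En 22) // (En 0) // (En 7) // (En 23) // (par_beta ts) (par_w ts) //.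
by rewrite !le_flag mulnb addn1.
Qed.

(** By [sort_by_class], for [v = k] and the class counts of [C] this is the sorted list whose prefix
    sums are [mu]. *)
Definition heavy_prefix (c : nat -> nat) v := flatten [seq nseq (c u) (w u) | u <- iota 0 v].

Lemma heavy_prefixS c v : heavy_prefix c v.+1 = heavy_prefix c v ++ nseq (c v) (w v).
Proof. by rewrite /heavy_prefix -addn1 iotaD map_cat flatten_cat /= cats0. Qed.

Definition prefix_sums s (F : seq nat) :=
  nmem s vH 0 = size F /\ forall l, l <= size F -> nmem s vMu l = sumn (take l F).

Lemma run_mu_inner_loop s F v : tables s -> v < k -> nmem s vV 0 = v ->
  nmem s vC v <= n -> prefix_sums s F ->
  prefix_sums (run mu_inner_loop s) (F ++ nseq (nmem s vC v) (w v)).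
Proof.
move=> ts lt_v hv le_c hF.
pose Inv j (s' : state R) := prefix_sums s' (F ++ nseq (minn j (nmem s vC v)) (w v)).
have : Inv n (run mu_inner_loop s).
  apply: (run_for_ind (Inv := Inv) (par_n ts)) => //.
    by rewrite /Inv min0n cats0.
  move=> j s' lt_j En _ [IHh IHm]; rewrite /Inv /prefix_sums run_seq !run_SN /= !addn1.
  rewrite !(En 20) // (En 22) // (En 7) // hv (par_w ts) // IHh le_flag.
  set F' := F ++ _ in IHh IHm *.
  case: (ltnP j (nmem s vC v)) => [lt_jc|le_cj].
    have -> : F ++ nseq (minn j.+1 (nmem s 22 v)) (w v) = rcons F' (w v).
      rewrite /F' (minn_idPl lt_jc) (minn_idPl (ltnW lt_jc)) -cats1 -catA; congr cat.
      by rewrite -(nseqD j 1) addn1.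
    rewrite size_rcons addn1; split=> // l; rewrite leq_eqVlt ltnS.
    case: eqP => [-> _|_ /= le_l].
      rewrite take_oversize ?size_rcons // sumn_rcons IHm // take_size //.
    by rewrite IHm // -cats1 takel_cat.
  have -> : minn j.+1 (nmem s 22 v) = minn j (nmem s 22 v) by lia.
  rewrite -/F' addn0; split=> // l le_l; rewrite IHm //.
  by case: eqP => [el|_]; [rewrite el ltnn in le_l | apply: IHm].
by rewrite /Inv (minn_idPr le_c).
Qed.

Lemma run_mu_loop s : tables s -> (forall v, v < k -> nmem s vC v <= n) ->
  nmem s vH 0 = 0 -> nmem s vMu 0 = 0 ->
  prefix_sums (run mu_loop s) (heavy_prefix (nmem s vC) k).
Proof.
move=> ts le_c h0 m0.
pose Inv j (s' : state R) := prefix_sums s' (heavy_prefix (nmem s vC) j).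
apply: (run_for_ind (Inv := Inv) (par_K ts)) => //.
  by split=> // l; rewrite leqn0 => /eqP->.
move=> j s' lt_j En Er IH; rewrite /Inv heavy_prefixS -(En 22) //.
apply: (@run_mu_inner_loop (nset s' 20 j)) => //.
  apply: tablesW ts; last exact: Er.
  apply: agree_trans (agree_frame En _) _ => //.
  by move=> A; rewrite !inE; do ![case/orP]; move/eqP->.
  by rewrite /= En // le_c.
by rewrite En.
Qed.

Lemma run_lift_inner_loop s v : tables s -> v < k -> nmem s vV 0 = v ->
  nmem s vPi v = 0 ->
  nmem (run lift_inner_loop s) vPi =1 [eta nmem s vPi with v |->
    \max_(h < B) (h * ((h <= nmem s vSC 0) && (nmem s vMu h <= w v)))].
Proof.
move=> ts lt_v hv h0.
pose Inv j (s' : state R) := nmem s' vPi =1 [eta nmem s vPi with v |->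
    \max_(h < j) (h * ((h <= nmem s vSC 0) && (nmem s vMu h <= w v)))].
apply: (run_for_ind (Inv := Inv) (par_B ts)) => //.
  by move=> u /=; rewrite big_ord0; case: eqP => // ->.
move=> j s' lt_j En _ IH u; rewrite run_SN /= big_ord_recr /=.
rewrite !(En 20) // hv (En 24) // (En 27) // (En 7) // (par_w ts) //.
by rewrite !IH /= eqxx !le_flag mulnb max_flag; case: eqP.
Qed.

Lemma run_lift_loop s : tables s -> forall v, v < k ->
  nmem (run lift_loop s) vPi v =
    \max_(h < B) (h * ((h <= nmem s vSC 0) && (nmem s vMu h <= w v))).
Proof.
move=> ts.
pose Inv j (s' : state R) := forall v, v < j -> nmem s' vPi v =
    \max_(h < B) (h * ((h <= nmem s vSC 0) && (nmem s vMu h <= w v))).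
apply: (run_for_ind (Inv := Inv) (par_K ts)) => //.
move=> j s' lt_j En Er IH v; rewrite ltnS leq_eqVlt => lt_v.
rewrite run_seq (@run_lift_inner_loop _ j); rewrite ?run_SN //=.
- case: eqP lt_v => [-> _|_ /= /IH //]; by rewrite (En 24) // (En 27).
- apply: tablesW ts; last exact: Er.
  apply: agree_trans (agree_frame En _) _ => //.
  by move=> A; rewrite !inE; do ![case/orP]; move/eqP->.
- by rewrite eqxx.
Qed.

(** The fields quantify over all [C] with code [z], as the data depend on the code alone. A number
    that encodes no set leaves most fields void; it is rejected later, when a digit is found to
    exceed its class. *)
Record cover_computed z s : Prop := CoverComputed {
  cov_tables :> tables s;
  cov_digit : forall v, v < k -> nmem s vC v = digit B z v;
  cov_weight : forall C, code a C = z -> nmem s vWC 0 = weight a C;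
  cov_card : forall C, code a C = z -> nmem s vSC 0 = #|C|;
  cov_minimal : forall C, code a C = z ->
    nmem s vBad 0 = 0 <-> minimal_cover a beta C;
  cov_mu : forall C, code a C = z ->
    forall h, h <= #|C| -> nmem s vMu h = mu a C h;
  cov_lift : forall C, code a C = z ->
    forall v, v < k -> nmem s vPi v = lift_value a C (w v) }.

Definition cover_arrays :=
  table_arrays ++ [:: vC; vWC; vSC; vBad; vMu; vPi].

Lemma cover_computedW z s s' : agree cover_arrays s s' ->
  rmem s' rTop = rmem s rTop -> cover_computed z s -> cover_computed z s'.
Proof.
move=> E Er [ht ? ? ? ? ? ?]; split; rewrite ?E //.
by apply: tablesW ht => // A hA; apply: E; rewrite mem_cat hA.
Qed.

Lemma sum_bool_eq0 m (P : nat -> bool) :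
  \sum_(v < m) P v = 0 <-> forall v, v < m -> ~~ P v.
Proof.
split=> [/eqP|h]; last by rewrite big1 // => v _; rewrite (negbTE (h v _)).
rewrite sum_nat_eq0 => /forallP h v lt_v.
by have := h (Ordinal lt_v); rewrite /= eqb0.
Qed.

Lemma run_cover_data s z : tables s -> z < M -> nmem s vZC 0 = z ->
  cover_computed z (run cover_data s).
Proof.
move=> ts lt_z hz; rewrite /cover_data !run_seq.
set s1 := run (SN 24 _ _) _; set s2 := run cover_loop s1.
set s3 := run (SN 25 _ _) s2; set s4 := run minimal_loop s3.
set s5 := run (SN 26 _ _) _; set s6 := run mu_loop s5.
have ts1 : tables s1.
  apply: tablesW ts; rewrite /s1 ?run_SN // => A.
  by rewrite !inE; do ![case/orP]; move/eqP->.
have ts2 : tables s2.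
  by apply: tablesW ts1; [apply: agree_run | rewrite /s2 run_rframe].
have ts3 : tables s3.
  by apply: tablesW ts2; [apply: agree_run | rewrite /s3 run_rframe].
have ts4 : tables s4.
  by apply: tablesW ts3; [apply: agree_run | rewrite /s4 run_rframe].
have ts5 : tables s5.
  apply: tablesW ts4; rewrite /s5 ?run_SN // => A.
  by rewrite !inE; do ![case/orP]; move/eqP->.
have ts6 : tables s6.
  by apply: tablesW ts5; [apply: agree_run | rewrite /s6 run_rframe].
have cur1 : nmem s1 vCur 0 = z by rewrite /s1 !run_SN.
have wc1 : nmem s1 vWC 0 = 0 by rewrite /s1 !run_SN.
have sc1 : nmem s1 vSC 0 = 0 by rewrite /s1 !run_SN.
have [] := run_cover_loop ts1 lt_z cur1 wc1 sc1; rewrite -/s2 => hC hW hS.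
have f52 A : A \notin [:: 20; 25; 26; 27] -> nmem s5 A = nmem s2 A.
  rewrite !inE !negb_or => /and4P[h20 h25 h26 h27].
  rewrite /s5 !run_SN /= (negbTE h26) (negbTE h27) /s4 run_nframe.
    by rewrite /s3 run_SN /= (negbTE h25).
  by rewrite /= !inE negb_or h20 h25.
have hmu : prefix_sums s6 (heavy_prefix (nmem s2 vC) k).
  rewrite -(f52 22) //; apply: run_mu_loop => //; try by rewrite /s5 !run_SN.
  by move=> v lt_v; rewrite f52 // hC // -ltnS ltn_mod.
have f72 A : A \notin [:: 12; 20; 25; 26; 27; 28] -> nmem (run lift_loop s6) A = nmem s2 A.
  rewrite !inE !negb_or => /and5P[h12 h20 h25 h26 /andP[h27 h28]].
  rewrite run_nframe; last by rewrite /= !inE !negb_or h12 h20 h28.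
  rewrite /s6 run_nframe; last by rewrite /= !inE !negb_or h12 h20 h26 h27.
  by rewrite f52 // !inE !negb_or h20 h25 h26.
have cntC C v : code a C = z -> v < k -> nmem s2 vC v = cnt C v.
  by move=> eC lt_v; rewrite hC // -eC digit_code.
have hpre C : code a C = z ->
    heavy_prefix (nmem s2 vC) k = sort geq [seq tnth a i | i in C].
  move=> eC; rewrite sort_by_class; congr flatten; apply/eq_in_map => v.
  by rewrite mem_iota => /= lt_v; rewrite (cntC C).
have hSC C : code a C = z -> nmem s2 vSC 0 = #|C|.
  move=> eC; rewrite hS (card_by_class a); apply: eq_bigr => v _.
  by rewrite -(cntC C) ?hC.
have hWC C : code a C = z -> nmem s2 vWC 0 = weight a C.
  move=> eC; rewrite hW weight_by_class; apply: eq_bigr => v _.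
  by rewrite -(cntC C) ?hC.
have hMu C : code a C = z -> forall h, h <= #|C| -> nmem s6 vMu h = mu a C h.
  move=> eC h le_h; have [_ ->] := hmu; first by rewrite (hpre C).
  by rewrite (hpre C) // size_sort size_image.
split.
- by apply: tablesW ts6; [apply: agree_run | rewrite run_rframe].
- by move=> v lt_v; rewrite f72 // hC.
- by move=> C eC; rewrite f72 //; apply: hWC.
- by move=> C eC; rewrite f72 //; apply: hSC.
- move=> C eC; rewrite run_nframe // /s6 run_nframe // /s5 !run_SN /=.
  rewrite run_minimal_loop // minimal_coverE /s3 run_SN /= (par_beta ts2).
  have badE := sum_bool_eq0 k
    (fun v => (0 < nmem s2 22 v) && (beta + w v < weight a C)).
  rewrite le_flag (hWC C) //; split=> [/eqP|[cov hmin]].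
    rewrite addn_eq0 eqb0 -ltnNge => /andP[cov /eqP/badE hmin]; split=> // v lt_v.
    by move=> c_gt0; have := hmin v lt_v; rewrite /= (cntC C) // c_gt0 -leqNgt.
  rewrite leqNgt cov; apply/badE => v lt_v.
  rewrite /= (cntC C) //; apply/negP => /andP[c_gt0].
  by rewrite ltnNge (hmin v lt_v c_gt0).
- by move=> C eC h le_h; rewrite run_nframe // (hMu C).
- move=> C eC v lt_v; rewrite run_lift_loop //.
  rewrite [nmem s6 24]run_nframe // f52 // (hSC C) //.
  have le_CB : #|C|.+1 <= B by rewrite ltnS -[leqRHS]card_ord max_card.
  rewrite /lift_value (big_ord_widen_cond B (fun h => mu a C h <= w v) id) //.
  rewrite [RHS]big_mkcond; apply: eq_bigr => h _; rewrite ltnS.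
  case: leqP => [le_h|_]; last by rewrite andbF muln0.
  by rewrite andbT (hMu C) //; case: (_ <= _); rewrite ?muln1 ?muln0.
Qed.

End CoverData.

(** * Table of independence and test for violation *)

Section Separation.
Variables (R : realType) (n : nat) (a : n.-tuple nat) (beta : nat).
Variable x : n.-tuple R.
Implicit Types (s : state R) (v t j z : nat) (C S : {set 'I_n}).
Local Notation k := (size (values a)).
Local Notation w := (nth 0 (values a)).
Local Notation B := n.+1.
Local Notation M := (n.+1 ^ size (values a)).
Local Notation V := (value_class a).
Local Notation cnt := (class_card a).
Local Notation tables := (tables a beta x).
Local Notation cover_computed := (cover_computed a beta x).

Lemma code_setU1 S i v : v < k -> i \in V v -> i \notin S ->
  code a (i |: S) = code a S + B ^ v.
Proof.
by move=> lt_v iV iS; rewrite (code_setD1 lt_v (setU11 _ _) iV) setU1K.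
Qed.

Lemma code_by_digits z S : z < M -> (forall v, v < k -> cnt S v = digit B z v) ->
  code a S = z.
Proof.
by move=> lt_z h; rewrite -[RHS](@sum_digit B _ k) //; apply: eq_bigr => v _; rewrite h.
Qed.

Lemma class_card_disjointU C S v : [disjoint C & S] ->
  class_card a (C :|: S) v = cnt C v + cnt S v.
Proof.
move=> dis; rewrite /class_card setIUl cardsU setIACA (disjoint_setI0 dis).
by rewrite set0I cards0 subn0.
Qed.

Lemma run_independent_loop s z : tables s -> z < M ->
  nmem s vCur 0 = z -> nmem s vZ 0 = z ->
  nmem s vWS 0 = 0 -> nmem s vHS 0 = 0 -> nmem s vBadS 0 = 0 ->
  let s' := run independent_loop s in
  [/\ nmem s' vWS 0 = \sum_(v < k) digit B z v * w v,
      nmem s' vHS 0 = \sum_(v < k) digit B z v * (nmem s vPi v).+1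
    & nmem s' vBadS 0 =
      \sum_(v < k) (0 < digit B z v) * (1 - nmem s vTab (z - B ^ v))].
Proof.
move=> ts lt_z hz hz' hW hH hB.
pose Inv j (s' : state R) := [/\ nmem s' vCur 0 = z %/ B ^ j,
  nmem s' vWS 0 = \sum_(v < j) digit B z v * w v,
  nmem s' vHS 0 = \sum_(v < j) digit B z v * (nmem s vPi v).+1
  & nmem s' vBadS 0 =
      \sum_(v < j) (0 < digit B z v) * (1 - nmem s vTab (z - B ^ v))].
suff : Inv k (run independent_loop s) by case.
apply: (run_for_ind (Inv := Inv) (par_K ts)) => //.
  by rewrite /Inv !big_ord0 divn1.
move=> j s' lt_j En _ [IHq IHW IHH IHB].
rewrite /next_digit !run_seq !run_SN /Inv !big_ord_recr /= ?eqxx.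
rewrite (En 8) // (En 3) // (En 7) // (En 28) // (En 33) // (En 6) // (En 19) //.
rewrite (par_B ts) (par_w ts) // (par_pow ts (ltnW lt_j)) IHq (tab_quo ts) ?quo_lt //.
by rewrite sub_divn_digit divn_expnS IHW IHH IHB hz' le_flag !addn1.
Qed.

Definition table_ok z s := forall C S, code a C = z -> S \subset ~: C ->
  nmem s vTab (code a S) = independent a beta C S.

(** Codes are visited in increasing order and removing an element lowers the code, so the entries
    consulted for [S] have already been recomputed for the present cover. *)
Lemma run_independent_table s z : cover_computed z s ->
  table_ok z (run independent_table s).
Proof.
move=> cov.
pose Inv j (s' : state R) := forall C S, code a C = z -> S \subset ~: C ->
  code a S < j -> nmem s' vTab (code a S) = independent a beta C S.
suff hI : Inv M (run independent_table s).
  by move=> C S eC sC; apply: hI => //; apply: code_lt.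
apply: (run_for_ind (Inv := Inv) (par_M cov)) => //.
move=> j s' lt_j En Er IH C S eC sC; rewrite !run_seq.
set s1 := run (SN 32 _ _) _; set s2 := run independent_loop s1.
have f1 A : A \notin [:: 19; 21; 30; 31; 32] -> nmem s1 A = nmem s' A.
  rewrite !inE !negb_or => /and5P[/negbTE h1 /negbTE h2 /negbTE h3 /negbTE h4 /negbTE h5].
  by rewrite /s1 !run_SN /= h1 h2 h3 h4 h5.
have cov1 : cover_computed z s1.
  apply: cover_computedW cov => [A hA|]; last by rewrite /s1 !run_SN /= Er.
  by rewrite f1 ?En //; move: A hA; apply/allP.
have z1 : nmem s1 vZ 0 = j by rewrite /s1 !run_SN.
have c1 : nmem s1 vCur 0 = j by rewrite /s1 !run_SN.
have [] := run_independent_loop (cov_tables cov1) lt_j c1 z1 _ _ _.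
- by rewrite /s1 !run_SN.
- by rewrite /s1 !run_SN.
- by rewrite /s1 !run_SN.
rewrite -/s2 => hWS hHS hBad.
have f2 A : A \notin [:: 20; 29; 21; 30; 31; 32] -> nmem s2 A = nmem s1 A.
  by move=> hA; rewrite /s2 run_nframe //; apply: contra hA; move: A; apply/allP.
have tabs : nmem s2 33 = nmem s' 33 by rewrite f2 // f1.
rewrite run_SN /= (f2 19) // z1 ltnS leq_eqVlt.
case: eqP => [eS _|_ /= lt_S]; last by rewrite tabs; apply: IH.
have digS v : v < k -> digit B j v = cnt S v by move=> lt_v; rewrite -eS digit_code.
have prevE i v : v < k -> i \in S -> i \in V v ->
    nmem s1 33 (j - B ^ v) = independent a beta C (S :\ i).
  move=> lt_v iS iV; rewrite f1 //.
  have eS' := code_setD1 lt_v iS iV; rewrite -eS eS' addnK; apply: IH => //.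
    by apply: subset_trans sC; apply: subD1set.
  by rewrite -eS eS' -addn1 leq_add2l expn_gt0.
(* All [S :\ i] with [i] in the same class share one code, so one look-up per class met by [S] tests
   them all. *)
have badE : (nmem s2 32 0 <= 0) = [forall i in S, independent a beta C (S :\ i)].
  rewrite leqn0 hBad sum_nat_eq0; apply/forallP/forall_inP => [h i iS|h v].
    have lt_v := class_lt a i; have iV : i \in V (index (tnth a i) (values a)).
      by rewrite mem_class.
    have := h (Ordinal lt_v); rewrite /= (prevE i) // digS // muln_eq0 eqb0 -leqNgt leqn0.
    rewrite cards_eq0; case: eqP => [/setP/(_ i)|_] /=.
      by rewrite in_setI iS iV inE.
    by case: (independent _ _ _ _).
  rewrite digS //; case: posnP => //= /card_gt0P[i /setIP[iS iV]].
  by rewrite (prevE i) // h.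
rewrite independent_rec // -badE andbC -mulnb le_flag; congr (_ * _).
(* With truncated subtraction [m - (m - p)] is [minn m p], the capped argument of [mu] from
   [good_by_class]. *)
rewrite (f2 27) // (f2 24) // (f2 0) // (f2 23) // le_flag -minnE addn1.
rewrite (par_beta cov1) (cov_card cov1 eC) (cov_weight cov1 eC).
rewrite (cov_mu cov1 eC) ?geq_minr // good_by_class hHS hWS.
congr (nat_of_bool (mu _ _ (minn _ _) + _ < _ + _)).
  by apply: eq_bigr => v _; rewrite digS // (cov_lift cov1 eC).
by apply: eq_bigr => v _; rewrite digS.
Qed.

Lemma run_violation_loop s z : tables s -> z < M ->
  nmem s vCur 0 = z -> nmem s vZ 0 = z -> rmem s rVal 0 = 0%R ->
  let s' := run violation_loop s in
  nmem s' vBadS 0 = nmem s vBadS 0 +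
      \sum_(v < k) ((#|V v| < nmem s vC v + digit B z v) +
         (nmem s vC v + digit B z v < #|V v|) * nmem s vTab (z + B ^ v)) /\
  ((forall v, v < k -> nmem s vC v + digit B z v <= #|V v|) ->
   rmem s' rVal 0 =
     (\sum_(v < k) class_value a x v (nmem s vPi v) (nmem s vC v) (digit B z v))%R).
Proof.
move=> ts lt_z hz hz' hv0.
pose Inv j (s' : state R) := [/\ nmem s' vCur 0 = z %/ B ^ j,
  nmem s' vBadS 0 = nmem s vBadS 0 +
      \sum_(v < j) ((#|V v| < nmem s vC v + digit B z v) +
         (nmem s vC v + digit B z v < #|V v|) * nmem s vTab (z + B ^ v)) &
  (forall v, v < k -> nmem s vC v + digit B z v <= #|V v|) ->
   rmem s' rVal 0 =
     (\sum_(v < j) class_value a x v (nmem s vPi v) (nmem s vC v) (digit B z v))%R].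
suff : Inv k (run violation_loop s) by case.
apply: (run_for_ind (Inv := Inv) (par_K ts)) => //.
  by rewrite /Inv !big_ord0 divn1 addn0.
move=> j s' lt_j En Er [IHq IHB IHV].
have card_lt : #|V j| < B by rewrite ltnS -[leqRHS]card_ord max_card.
rewrite /next_digit !run_seq run_SR !run_SN /Inv !big_ord_recr /= ?eqxx.
rewrite (En 8) // (En 3) // (En 9) // (En 22) // (En 33) // (En 6) // (En 19) // (En 28) //.
rewrite (par_B ts) (par_pow ts (ltnW lt_j)) IHq (tab_quo ts) ?quo_lt // (tab_card ts) //.
rewrite sub_divn_digit divn_expnS !addn1 !le_flag hz' IHB -!addnA; split=> // hcs.
have hj := hcs j lt_j.
have cd_lt := leq_ltn_trans hj card_lt.
have d_lt := leq_ltn_trans (leq_addl _ _) cd_lt.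
have sub_lt := leq_ltn_trans (leq_subr (nmem s 22 j) _) card_lt.
rewrite IHV // (Er 1) // !(tab_top ts) //.
rewrite /class_value; case: (nmem s 28 j) => [|p] /=.
  by rewrite mul1r mul0r addr0.
by rewrite mul0r add0r mul1r.
Qed.

Definition violated C S := [/\ minimal_cover a beta C, maximal_independent a beta C S
                & (lci_rhs R C < lci_lhs a C S x)%R].

(** A violated inequality stays violated when its left-hand side is replaced by the computed value,
    by [lci_lhs_le]. Conversely, [split_value_attained] provides sets with the given codes whose
    left-hand side equals that value. *)
Lemma run_violations s z : z < M -> cover_computed z s -> table_ok z s ->
  nmem (run violations s) vAns 0 != 0 <->
  nmem s vAns 0 != 0 \/ exists C S, code a C = z /\ violated C S.
Proof.
move=> lt_z cov tab.
pose Inv j (s' : state R) := nmem s' vAns 0 != 0 <->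
  nmem s vAns 0 != 0 \/ exists C S, [/\ code a C = z, code a S < j & violated C S].
have hI : Inv M (run violations s).
  apply: (run_for_ind (Inv := Inv) (par_M cov)) => //.
    by split=> [h|[//|[C [S []]]//]]; left.
  move=> j s' lt_j En Er IH; rewrite !run_seq.
  set s1 := run (SR 2 _ _) _; set s2 := run violation_loop s1.
  have f1 A : A \notin [:: 19; 21; 32] -> nmem s1 A = nmem s' A.
    rewrite !inE !negb_or => /and3P[/negbTE h1 /negbTE h2 /negbTE h3].
    by rewrite /s1 run_SR !run_SN /= h1 h2 h3.
  have f0 A : A \notin [:: 2; 16; 19; 20; 21; 29; 32] -> nmem s1 A = nmem s A.
    move=> hA; rewrite f1 ?En //; first by apply: contra hA; move: A; apply/allP.
    by apply: contra hA; move: A; apply/allP.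
  have cov1 : cover_computed z s1.
    apply: cover_computedW cov => [A hA|]; last by rewrite /s1 run_SR !run_SN /= Er.
    by rewrite f0 //; move: A hA; apply/allP.
  have z1 : nmem s1 vZ 0 = j by rewrite /s1 run_SR !run_SN.
  have c1 : nmem s1 vCur 0 = j by rewrite /s1 run_SR !run_SN.
  have v1 : rmem s1 rVal 0 = 0%R by rewrite /s1 run_SR !run_SN /=.
  have b1 : nmem s1 vBadS 0 = nmem s vBad 0.
    by rewrite /s1 run_SR !run_SN /= En.
  have [] := run_violation_loop (cov_tables cov1) lt_j c1 z1 v1.
  rewrite -/s2 b1 => hBad hVal.
  have f2 A : A \notin [:: 20; 29; 21; 32] -> nmem s2 A = nmem s1 A.
    by move=> hA; rewrite /s2 run_nframe //; apply: contra hA; move: A; apply/allP.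
  have cC v : v < k -> nmem s1 vC v = digit B z v by exact: cov_digit cov1 v.
  rewrite /Inv run_SN run_SLe /= (f2 2) // (f1 2) // (f2 24) // (f2 33) // (f2 19) // z1.
  rewrite (f0 33) // le_flag mulnA.
  set val := rmem s2 2 0 in hVal *; set T := (_ <= _)%R.
  have -> : (nmem s' 2 0 + (1 - T) * (nmem s2 32 0 <= 0) * nmem s 33 j != 0) =
     (nmem s' 2 0 != 0) || [&& ~~ T, nmem s2 32 0 == 0 & nmem s 33 j != 0].
    rewrite addn_eq0 negb_and leqn0; congr (_ || _).
    by rewrite !muln_eq0 !negb_or eqb0 negbK -andbA; case: T.
  suff step : [&& ~~ T, nmem s2 32 0 == 0 & nmem s 33 j != 0] <->
      exists C S, [/\ code a C = z, code a S = j & violated C S].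
    split=> [/orP[/IH[|[C [S [h1 h2 h3]]]]|/step[C [S [h1 h2 h3]]]]|].
    - by left.
    - by right; exists C, S; split=> //; apply: ltnW.
    - by right; exists C, S; split=> //; rewrite h2.
    - move=> h; apply/orP; case: h => [h|[C [S [h1]]]]; first by left; apply/IH; left.
      rewrite ltnS leq_eqVlt => /orP[/eqP h2|h2] h3.
        by right; apply/step; exists C, S.
      by left; apply/IH; right; exists C, S.
  have prevE C S i v : v < k -> i \in V v -> [disjoint C & S] -> i \notin C :|: S ->
      code a C = z -> code a S = j ->
      nmem s1 33 (j + B ^ v) = independent a beta C (i |: S).
    move=> lt_v iV dis; rewrite inE negb_or => /andP[iC iS] eC eS.
    rewrite (f0 33) // -eS -(code_setU1 lt_v iV iS); apply: tab => //.
    by rewrite subUset sub1set inE iC /= -disjoints_subset disjoint_sym.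
  have cntU C S v : [disjoint C & S] -> code a C = z -> code a S = j -> v < k ->
      nmem s1 22 v + digit B j v = class_card a (C :|: S) v.
    move=> dis eC eS lt_v; rewrite cC // -eC -eS !digit_code //.
    by rewrite class_card_disjointU.
  have badE C S : [disjoint C & S] -> code a C = z -> code a S = j ->
      nmem s2 32 0 == 0 <-> minimal_cover a beta C /\
        forall i, i \notin C :|: S -> ~~ independent a beta C (i |: S).
    move=> dis eC eS; rewrite hBad addn_eq0 sum_nat_eq0.
    split=> [/andP[/eqP/(cov_minimal cov eC) minC /forallP h]|[/(cov_minimal cov eC)-> h]].
      split=> // i iCS; have lt_v := class_lt a i; set v := index _ _ in lt_v.
      have iV : i \in V v by rewrite mem_class.
      have := h (Ordinal lt_v); rewrite /= addn_eq0 (cntU C S) // => /andP[_].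
      rewrite (prevE C S i) // muln_eq0 !eqb0 => /orP[/negP[]|//].
      rewrite ltn_neqAle class_card_le andbT; apply/negP => /eqP eq_c.
      have : (C :|: S) :&: V v = V v.
        by apply/eqP; rewrite eqEcard subsetIr -eq_c leqnn.
      by move/setP/(_ i); rewrite in_setI iV (negbTE iCS).
    rewrite eqxx; apply/forallP => v; rewrite (cntU C S) //= ltnNge class_card_le /=.
    case: ltnP => //= lt_c.
    have /card_gt0P[i] : 0 < #|V v :\: (C :|: S)|.
      by rewrite cardsD setIC subn_gt0.
    by rewrite inE => /andP[iCS iV]; rewrite (prevE C S i) // (negbTE (h i iCS)).
  split=> [/and3P[notT bad0 tab0]|[C [S [eC eS [minC /maximal_independentE[ind mx] viol]]]]].
    have le_c v : v < k -> nmem s1 22 v + digit B j v <= #|V v|.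
      move=> lt_v; move: bad0; rewrite hBad addn_eq0 sum_nat_eq0 => /andP[_ /forallP].
      by move/(_ (Ordinal lt_v)); rewrite /= addn_eq0 eqb0 -leqNgt => /andP[].
    (* The counts fit into the classes, so sets attaining the computed value exist; having the
       prescribed codes, they inherit every property tested. *)
    have [C [S [dis hC hS hval]]] := @split_value_attained _ a _ x
      (nmem s1 28) (nmem s1 22) (digit B j) le_c.
    have eC : code a C = z by apply: code_by_digits => // v lt_v; rewrite hC // cC.
    have eS : code a S = j by apply: code_by_digits.
    have [minC mx] := (badE C S dis eC eS).1 bad0.
    have sC : S \subset ~: C by rewrite -disjoints_subset disjoint_sym.
    exists C, S; split=> //; split=> //.
      apply/maximal_independentE; split=> //.
      by move: tab0; rewrite -eS (tab C S eC sC); case: (independent _ _ _ _).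
    rewrite lci_lhsE // (eq_bigr (fun v : 'I_k =>
      class_value a x v (nmem s1 28 v) (nmem s1 22 v) (digit B j v))); last first.
      by move=> v _; rewrite -hval // (cov_lift cov1 eC).
    by move: notT; rewrite /T (hVal le_c) -ltNge (cov_card cov1 eC).
  have sC : S \subset ~: C by move: ind; rewrite independentE => /andP[].
  have dis : [disjoint C & S] by rewrite disjoint_sym disjoints_subset.
  have le_c v : v < k -> nmem s1 22 v + digit B j v <= #|V v|.
    by move=> lt_v; rewrite (cntU C S) // class_card_le.
  apply/and3P; split.
  - rewrite /T (hVal le_c) -ltNge (cov_card cov1 eC); apply: lt_le_trans viol _.
    apply: le_trans (@lci_lhs_le _ a _ x C S dis) _; rewrite le_eqVlt; apply/orP; left; apply/eqP.
    apply: eq_bigr => v _.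
    by rewrite (cov_lift cov1 eC) // cC // -eC -eS !digit_code.
  - by apply/(badE C S).
  - by rewrite -eS (tab C S) // ind.
apply: (iff_trans hI); split=> -[|[C [S]]]; try by left.
  by case=> h1 _ h2; right; exists C, S.
by case=> h1 h2; right; exists C, S; split=> //; apply: code_lt.
Qed.

Lemma run_separate s : tables s -> (forall i : 'I_n, 0 < tnth a i <= beta) ->
  nmem s vAns 0 = 0 ->
  accepts (run separate s) <-> exists_violated_lci a beta x.
Proof.
move=> ts a_bounds ans0.
pose Inv j (s' : state R) := nmem s' vAns 0 != 0 <->
  exists C S, code a C < j /\ violated C S.
have hI : Inv M (run separate s).
  apply: (run_for_ind (Inv := Inv) (par_M ts)) => //.
    by rewrite /Inv ans0; split=> // -[C [S []]].
  move=> j s' lt_j En Er IH; rewrite /Inv 2!run_seq.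
  set s0 := nset s' 18 j.
  have ts0 : tables s0.
    apply: tablesW ts; last exact: Er.
    apply: agree_trans (agree_frame En _) _ => //.
    by move=> A; rewrite !inE; do ![case/orP]; move/eqP->.
  have cov := run_cover_data ts0 lt_j (erefl _ : nmem s0 vZC 0 = j).
  have tab := run_independent_table cov.
  have cov' : cover_computed j (run independent_table (run cover_data s0)).
    by apply: cover_computedW cov; [apply: agree_run | rewrite run_rframe].
  have ansE : nmem (run independent_table (run cover_data s0)) vAns = nmem s' vAns.
    by rewrite run_nframe // run_nframe.
  have := run_violations lt_j cov' tab; rewrite ansE => -[viol1 viol2].
  split=> [/viol1[/IH[C [S [h1 h2]]]|[C [S [h1 h2]]]]|[C [S []]]].
  - by exists C, S; split=> //; apply: ltnW.
  - by exists C, S; rewrite h1.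
  - rewrite ltnS leq_eqVlt => /orP[/eqP h1|h1] h2; apply: viol2;
    by [right; exists C, S | left; apply/IH; exists C, S].
apply: (iff_trans hI); split=> -[C [S]]; first by case=> _; exists C, S.
by exists C, S; split=> //; apply: code_lt.
Qed.

End Separation.

(** * Running time *)

Section Time.
Variables (n k M : nat).
Hypotheses (k_gt0 : 0 < k) (k_le_n : k <= n) (n_lt_M : n < M).
Variable r : nat -> nat.
Hypotheses (r_n : r vSize = n) (r_B : r vB = n.+1) (r_k : r vK = k) (r_M : r vM = M).

(** The [M * M] pairs of codes with [k] steps each dominate. The tables cost terms like
    [k * (n * n)] and the covers terms like [M * (k * n)], which are smaller since [k <= n < M];
    2000 leaves room for the sum of all coefficients. *)
Lemma time_bound : time r find_values + time r find_powers + time r solve <=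
  2000 * (k * (M * M)).
Proof.
rewrite /= r_n r_B r_k r_M; set p := k * (M * M).
have M_gt0 : 0 < M by lia.
have kM : M * k <= p by rewrite /p; nia.
have MM : M * M <= p by rewrite /p; nia.
have MMk : M * (M * k) <= p by rewrite /p; nia.
have M1 : M <= p by nia.
have kn : k * n <= p by nia.
have nn : n * n <= p by nia.
have knn : k * (n * n) <= p by rewrite /p; nia.
have Mkn : M * (k * n) <= p by rewrite /p; nia.
move: kM MM MMk M1 kn nn knn Mkn; move: p => p; lia.
Qed.

End Time.

(** Bernoulli's inequality [(1 - 1/(n+1))^m >= 1 - m/(n+1)] with denominators cleared. *)
Lemma expn_succ_mul n m : m <= n.+1 -> n.+1 ^ m * (n.+1 - m) <= n ^ m * n.+1.
Proof.
elim: m => [|m IH] lt_m; first by rewrite !mul1n subn0.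
have := IH (ltnW lt_m); rewrite !expnS.
set p := n.+1 ^ m; set q := n ^ m => h.
have h2 : n.+1 * (n.+1 - m.+1) <= n * (n.+1 - m) by nia.
have := leq_mul (leqnn p) h2; have := leq_mul (leqnn n) h.
nia.
Qed.

(** For such [m] the factor [n + 1 - m] in Bernoulli's inequality is at least half of [n + 1]. *)
Lemma expn_succ_le2 n m : m.*2 <= n.+1 -> n.+1 ^ m <= 2 * n ^ m.
Proof.
move=> le_m; have le_mn : m <= n.+1 by lia.
have h := expn_succ_mul le_mn; rewrite -(leq_pmul2r (ltn0Sn n)).
have : n.+1 ^ m * n.+1 <= n.+1 ^ m * (2 * (n.+1 - m)).
  by rewrite leq_mul2l; apply/orP; right; lia.
by move=> h2; apply: leq_trans h2 _; rewrite mulnCA -mulnA leq_mul2l.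
Qed.

(* [(1 + 1/n)^n <= 4] *)
Lemma expn_succ_le4 n m : m <= n -> n.+1 ^ m <= 4 * n ^ m.
Proof.
move=> le_m.
(* The exponent is split into two halves, each at most [(n + 1) / 2]; each half costs a factor 2. *)
have eb b : b ^ m = b ^ (odd m + m./2) * b ^ m./2.
  by rewrite -expnD -addnA addnn odd_double_half.
have h1 : n.+1 ^ (odd m + m./2) <= 2 * n ^ (odd m + m./2).
  by apply: expn_succ_le2; lia.
have h2 : n.+1 ^ m./2 <= 2 * n ^ m./2 by apply: expn_succ_le2; lia.
by rewrite !eb; apply: leq_trans (leq_mul h1 h2) _; rewrite mulnACA.
Qed.

Theorem theorem1 (R : realType) :
  exists (prog : cmd) (K : nat),
  forall (n : nat) (a : n.-tuple nat) (beta sigma : nat) (x : n.-tuple R),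
    0 < beta -> 0 < sigma -> is_sparse a sigma ->
    (forall i : 'I_n, 0 < tnth a i <= beta) ->
    beta < \sum_(i < n) tnth a i ->
    exists (t : nat) (s : state R),
      [/\ exec prog (input_state a beta x) t s,
          t <= K * (sigma ^ 2 * n ^ (2 * sigma))
        & accepts s <-> exists_violated_lci a beta x].
Proof.
exists (Seq (compile find_values) (Seq (compile find_powers) (compile solve))).
(* 2000 comes from [time_bound]; 16 is the square of the 4 in [(n + 1)^k <= 4 n^k], one factor for
   each code of a pair. *)
exists (2000 * 16) => n a beta sigma x beta_gt0 sigma_gt0 sparse a_bounds cover.
set s0 := input_state a beta x; set k := size (values a); set M := n.+1 ^ k.
have n_gt0 : 0 < n.
  by case: n a x a_bounds cover {s0 k M sparse} => // a x _; rewrite big_ord0.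
have le_kn : k <= n := k_le_n a.
have k_gt0 : 0 < k by apply: leq_ltn_trans (class_lt a (Ordinal n_gt0)).
have [hB hk hW] := @run_find_values R n a beta a_bounds s0 erefl erefl erefl erefl.
set s1 := run find_values s0 in hB hk hW.
have [hP hM] := run_find_powers hB hk; set s2 := run find_powers s1 in hP hM.
have par2 : parameters a beta s2.
  by split; rewrite // run_nframe // run_nframe.
have hx2 : rmem s2 0 = nth 0%R x by rewrite run_rframe // run_rframe.
have hq2 z : nmem s2 8 z = 0 by rewrite run_nframe // run_nframe.
have ts := run_find_tables par2 hx2 hq2.
have [t1 ex1 le1] := @exec_run R find_values s0 isT.
have [t2 ex2 le2] := @exec_run R find_powers s1 isT.
have [t3 ex3 le3] := @exec_run R solve s2 isT.
exists (t1 + (t2 + t3)), (run solve s2); split.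
- by apply: ExecSeq ex1 _; apply: ExecSeq ex2 ex3.
(* The cost of each stage refers to the state in which it starts. The first two stages do not
   overwrite the loop bounds that they read, so all three costs can be expressed by the bounds in
   [s2]. *)
- pose r X := nmem s2 X 0.
  have h1 : time (nmem s0 ^~ 0) find_values = time r find_values.
    apply: eq_time => X; rewrite !inE => hX.
    by rewrite /r run_nframe ?run_nframe //; case/orP: hX => /eqP->.
  have h2 : time (nmem s1 ^~ 0) find_powers = time r find_powers.
    by apply: eq_time => X; rewrite !inE => /eqP->; rewrite /r (@run_nframe R find_powers).
  have n_lt_M : n < M by rewrite -[n.+1]expn1 leq_pexp2l.
  have := @time_bound n k M k_gt0 le_kn n_lt_M r (par_n par2) (par_B par2)
    (par_K par2) (par_M par2).
  rewrite -h1 -h2 => le_t.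
  apply: leq_trans (leq_add le1 (leq_add le2 le3)) _.
  rewrite addnA; apply: leq_trans le_t _.
  rewrite -mulnA leq_mul2l; apply/orP; right.
  have le_M : M * M <= 16 * n ^ (2 * sigma).
    have hM4 := expn_succ_le4 le_kn.
    apply: leq_trans (leq_mul hM4 hM4) _.
    rewrite mulnACA leq_mul2l -expnD addnn -mul2n /=.
    by rewrite leq_pexp2l // leq_mul2l /= /k size_values.
  have le_k : k <= sigma ^ 2.
    by apply: (@leq_trans sigma); rewrite ?/k ?size_values // leq_pmull.
  by apply: leq_trans (leq_mul le_k le_M) _; rewrite mulnCA.
- rewrite [run solve s2]run_seq; apply: run_separate => //.
  by rewrite run_nframe // run_nframe // run_nframe.
Qed.
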